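(* Let $(A,1,\nu)$ be an $A_\infty$-algebra with split unit such that $(\Pi A,\nu^1)$ is a semiprojective complex, and let $(M,p_M)$ be a strictly unital $A_\infty$-module over $(A,1,\nu)$. (1) Let $q:(G,p_G^0)\to(M,p_M^0)$ be a surjective semiprojective resolution of the complex underlying $(M,p_M)$. There exists $p_G\in CC_{\mathsf u}^\bullet(A,\mathrm{End}\,G)_0$, extending $p_G^0$ (i.e. with tensor degree zero component $p_G^0$), such that $(G,p_G)$ is a strictly unital $A_\infty$-module over $(A,1,\nu)$ and $q$ is a strict morphism of $A_\infty$-modules $(G,p_G)\to(M,p_M)$. (2) Let $q:(G,p_G)\to(M,p_M)$ and $\alpha:(N,p_N)\to(M,p_M)$ be morphisms of strictly unital $A_\infty$-modules over $(A,1,\nu)$. Assume that $(N,p_N^0)$ is a semiprojective complex, and that $q=q^0$ is strict, with $q^0:(G,p_G^0)\to(M,p_M^0)$ a surjective quasi-isomorphism of complexes. Then there exists a strictly unital morphism of $A_\infty$-modules $\delta:(N,p_N)\to(G,p_G)$ such that $q\delta=\alpha$. (3) In the setting of (2), if $H_1\big(CC^n(\overline A,\mathrm{Hom}(N,G)),d_{\overline A\mathrm{Hom}}\big)=0$ for all $n\ge1$, and $\delta,\delta':(N,p_N)\to(G,p_G)$ are two strictly unital morphisms with $q\delta=\alpha=q\delta'$, then $\delta$ and $\delta'$ are homotopic via a strictly unital homotopy. In particular, in the setting of (1), if $H_1\big(CC^n(\overline A,\mathrm{Hom}(G,G)),d_{\overline A\mathrm{Hom}}\big)=0$ for all $n\ge1$,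 then any two strictly unital $A_\infty$-module structures $p_G,\widetilde p_G\in CC_{\mathsf u}^\bullet(A,\mathrm{End}\,G)_0$ extending $p_G^0$, such that $q$ is a strict morphism to $(M,p_M)$ from each of $(G,p_G)$ and $(G,\widetilde p_G)$, are homotopy equivalent via strictly unital homotopies.
   Context: Conventions. $k$ is a fixed commutative ring; modules, complexes and maps are over $k$; complexes are unbounded with differentials of degree $-1$. For graded modules, $\mathrm{Hom}(M,N)_n=\prod_i\mathrm{Hom}(M_i,N_{i+n})$ and $(M\otimes N)_n=\bigoplus_i M_i\otimes N_{n-i}$, with $(f\otimes g)(x\otimes y)=(-1)^{|g||x|}f(x)\otimes g(y)$. For complexes, the differential on $\mathrm{Hom}(M,N)$ is $\delta_{\mathrm{Hom}}(f)=\delta_Nf-(-1)^{|f|}f\delta_M$, and that on $M\otimes N$ is $\delta_M\otimes1+1\otimes\delta_N$. $\Pi$ is the shift $(\Pi M)_n=M_{n-1}$, $s:M\to\Pi M$, $s(x)=[x]$, the degree one identity map, $\delta_{\Pi M}=-s\delta_Ms^{-1}$, $[x_1|\dots|x_n]=sx_1\otimes\cdots\otimes sx_n$. A complex $P$ is semiprojective if for every surjective quasi-isomorphism of complexes $f$, $\mathrm{Hom}(P,f)$ is a surjective quasi-isomorphism. A semiprojective resolution of $M$ is a quasi-isomorphism $P\to M$ with $P$ semiprojective. Cochains. For graded modules $A,B$: $CC^l(A,B)=\mathrm{Hom}((\Pi A)^{\otimes l},\Pi B)$ (graded), $CC^\bullet(A,B)=\prod_{l\ge1}CC^l(A,B)$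 and $CC_{\mathsf u}^\bullet(A,B)=\prod_{l\ge0}CC^l(A,B)=\Pi B\oplus CC^\bullet(A,B)$; elements are written $f=(f^l)$, $f^{\ge1}$ is the part of tensor degrees $\ge1$, and a subscript $i$ as in $CC^\bullet(A,B)_i$ denotes the degree $i$ part. Gerstenhaber product: $(\mu\circ\nu)^l=\sum_{1\le i\le l,\,0\le j\le i-1}\mu^i(1^{\otimes j}\otimes\nu^{l-i+1}\otimes1^{\otimes i-j-1})$ for $\mu\in CC^\bullet(A,B)$, $\nu\in CC^\bullet(A,A)$. $*$-product: $(\nu*\alpha)^l=\sum_{i_1+\dots+i_j=l}\nu^j(\alpha^{i_1}\otimes\cdots\otimes\alpha^{i_j})$ for $\alpha\in CC^\bullet(A,B)_0$, $\nu\in CC^\bullet(B,B)_{-1}$. $\star$-product: for $\alpha\in CC_{\mathsf u}^\bullet(A,\mathrm{Hom}(N,P))$, $\beta\in CC_{\mathsf u}^\bullet(A,\mathrm{Hom}(M,N))$, $(\alpha\star\beta)^n=s\gamma(s^{-1}\otimes s^{-1})\sum_{j=0}^n\alpha^j\otimes\beta^{n-j}\in CC^n(A,\mathrm{Hom}(M,P))$, where $\gamma$ is composition of maps. Algebras. A nonunital $A_\infty$-algebra is $(A,\nu)$ with $\nu\in CC^\bullet(A,A)_{-1}$, $\nu\circ\nu=0$. A morphism $(A,\nu_A)\to(B,\nu_B)$ is $\alpha\in CC^\bullet(A,B)_0$ with $\nu_B*\alpha=\alpha\circ\nu_A$. Given $1\in A_0$, $1\in B_0$, $\nu$ is strictly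 unital if $\nu^2[1|a]=[a]=(-1)^{|a|}\nu^2[a|1]$ for all $a\in A$ and $\nu^l$, $l\neq2$, vanishes whenever one argument is $[1]$; $\alpha$ is strictly unital if $\alpha^1[1]=[1]$ and $\alpha^l$, $l\ge2$, vanishes whenever one argument is $[1]$. A split element of a graded module $A$ is $1\in A_0$ generating a rank one free submodule, with a fixed splitting $A\to k$ of $k\to A$, $1\mapsto 1$. An $A_\infty$-algebra with split unit $(A,1,\nu)$ is a graded module with split element and an $A_\infty$-structure $\nu$ strictly unital with respect to $1$. $\overline A=A/(k\cdot1)$, and via $A\to\overline A$, $CC^n(\overline A,B)\subseteq CC^n(A,B)$ is the submodule of maps vanishing whenever one argument is $[1]$; similarly $CC_{\mathsf u}^\bullet(\overline A,B)\subseteq CC^\bullet_{\mathsf u}(A,B)$. Modules. For a complex $(M,\delta_M)$, $\mathrm{End}\,M=\mathrm{Hom}(M,M)$ is an $A_\infty$-algebra with structure $\nu_{\mathrm{End}}$ given by $\nu^1_{\mathrm{End}}=-s\delta_{\mathrm{Hom}}s^{-1}$, $\nu^2_{\mathrm{End}}=-s\gamma(s^{-1})^{\otimes2}$, other components zero; its unit is the identity of $M$. An $A_\infty$-module over $(A,\nu)$ is a graded module $M$ with $p_M\in CC_{\mathsf u}^\bullet(A,\mathrm{End}\,M)_0$ such that $p_M^0\in(\Pi\,\mathrm{End}\,M)_0$ corresponds to a differential on $M$ and $p_M^{\ge1}$ is a morphism of nonunital $A_\infty$-algebras $(A,\nu)\to(\mathrm{End}\,M,\nu_{\mathrm{End}})$,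 where $\mathrm{End}\,M$ is taken for the complex $(M,p_M^0)$. The complex $(M,p^0_M)$ is the underlying complex. The module is strictly unital if $p_M^{\ge1}$ is a strictly unital morphism. A morphism $(M,p_M)\to(N,p_N)$ of $A_\infty$-modules over $(A,\nu)$ is $f\in CC_{\mathsf u}^\bullet(A,\mathrm{Hom}(M,N))_1$ with $p_N\star f-f^{\ge1}\circ\nu+f\star p_M=0$. It is strict if $f^n=0$ for all $n\ge1$; a degree zero map $q:M\to N$ is regarded as the element $sq\in(\Pi\mathrm{Hom}(M,N))_1$ of tensor degree $0$. The composite of $f$ followed by $\widetilde f$ is $\widetilde f\star f$. A homotopy between morphisms $f,g:(M,p_M)\to(N,p_N)$ is $r\in CC_{\mathsf u}^\bullet(A,\mathrm{Hom}(M,N))_2$ with $f-g=r^{\ge1}\circ\nu+p_N\star r+r\star p_M$. A morphism (homotopy) is strictly unital if it lies in $CC_{\mathsf u}^\bullet(\overline A,\mathrm{Hom}(M,N))$. Two strictly unital modules are homotopy equivalent via strictly unital homotopies if there are strictly unital morphisms in both directions whose two composites are homotopic to the identities by strictly unital homotopies. For complexes $(N,p_N^0)$, $(G,p_G^0)$, the differential $d_{\overline A\mathrm{Hom}}$ on $CC^n(\overline A,\mathrm{Hom}(N,G))=\mathrm{Hom}((\Pi\overline A)^{\otimes n},\Pi\mathrm{Hom}(N,G))$ is the Hom-complex differential $f\mapsto\delta_{\Pi\mathrm{Hom}}f-(-1)^{|f|}f\circ\nu^1_{\overline A}$, where $\nu^1_{\overline A}:\Pi\overline A\to\Pi\overline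 A$ is induced by $\nu^1$.
   Formalization: In (2) and (3) the morphism α is assumed strictly unital; this is necessary, since qδ is strictly unital whenever δ is, and morphisms α between strictly unital modules need not be strictly unital. *)

(* Defs.v *)
From HB Require Import structures.
From mathcomp Require Import all_boot all_algebra.
From mathcomp Require Import boolp functions.
Set Implicit Arguments.
Unset Strict Implicit.
Unset Printing Implicit Defensive.
Import GRing.Theory.
Local Open Scope ring_scope.

(* The carrier of a graded k-module is the direct sum of its homogeneous
   pieces; [pr i] is the projection onto the piece of degree [i].
   [pr_sum] says that every element is the finite sum of its components. *)
Record gmod (k : comPzRingType) := Gmod {
  carrier :> lmodType k;
  pr : int -> {linear carrier -> carrier};
  prK : forall i j x, pr i (pr j x) = if i == j then pr j x else 0;
  pr_sum : forall x, exists2 s : seq int, uniq s & x = \sum_(i <- s) pr i x }.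

Definition homog (k : comPzRingType) (M : gmod k) (i : int) (x : M) : Prop :=
  pr M i x = x.

Section Components.
Variables (k : comPzRingType) (M : gmod k).

Definition supp (x : M) : seq int := s2val (cid2 (pr_sum x)).

(* The sum over all degrees i of F i applied to the component of degree i. *)
Definition gsum (V : zmodType) (F : int -> M -> V) (x : M) : V :=
  \sum_(i <- supp x) F i (pr M i x).

(* The linear map x |-> (-1)^(d * |x|) x *)
Definition gsg (d : int) (x : M) : M :=
  gsum (fun i y => (-1) ^+ `|(d * i)%R|%N *: y) x.

Lemma pr_homog i x : homog i (pr M i x).
Proof. by rewrite /homog prK eqxx. Qed.

Lemma pr_neq i j x : i != j -> homog j x -> pr M i x = 0.
Proof. by move=> ij <-; rewrite prK (negPf ij). Qed.

Lemma suppP x : uniq (supp x) /\ x = \sum_(i <- supp x) pr M i x.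
Proof. by rewrite /supp; case: cid2. Qed.

Lemma pr_out (x : M) s : x = \sum_(i <- s) pr M i x ->
  forall i, i \notin s -> pr M i x = 0.
Proof.
move=> hx i; rewrite hx linear_sum big_seq => h; apply: big1 => j js.
by rewrite prK; case: eqP => // ij; rewrite ij js in h.
Qed.

Lemma gsumE (V : zmodType) (F : int -> M -> V) x (s : seq int) :
  (forall i, F i 0 = 0) -> uniq s -> (forall i, i \notin s -> pr M i x = 0) ->
  gsum F x = \sum_(i <- s) F i (pr M i x).
Proof.
move=> F0 us hs; have [ut ht] := suppP x.
have red t : \sum_(i <- t) F i (pr M i x)
   = \sum_(i <- [seq i <- t | pr M i x != 0]) F i (pr M i x).
  rewrite big_filter (bigID (fun i => pr M i x != 0)) /= [X in _ + X]big1 ?addr0 //.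
  by move=> i; rewrite negbK => /eqP ->.
rewrite /gsum red [RHS]red; apply/perm_big/uniq_perm; rewrite ?filter_uniq //.
move=> i; rewrite !mem_filter; case: eqP => //= /eqP nz.
have -> : i \in supp x by apply: contraNT nz => /(pr_out ht)/eqP.
by apply/esym; apply: contraNT nz => /hs/eqP.
Qed.

Lemma gsum_homog (V : zmodType) (F : int -> M -> V) i x :
  (forall j, F j 0 = 0) -> homog i x -> gsum F x = F i x.
Proof.
move=> F0 hx; rewrite (@gsumE _ F x [:: i]) //; first by rewrite big_seq1 hx.
by move=> j; rewrite inE => ji; apply: pr_neq hx.
Qed.

Lemma gsum_pr (x : M) : gsum (fun _ => id) x = x.
Proof. exact/esym/(suppP x).2. Qed.

Lemma gsum_linear (V : lmodType k) (F : int -> M -> V) :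
  (forall i, linear (F i)) -> linear (gsum F).
Proof.
move=> Fl a x y; have F0 i : F i 0 = 0.
  by have := Fl i (-1) 0 0; rewrite scaler0 addr0 scaleN1r addNr.
pose s := undup (supp x ++ supp y).
have us : uniq s by apply: undup_uniq.
have hx i : i \notin s -> pr M i x = 0.
  rewrite mem_undup mem_cat negb_or => /andP[+ _].
  exact: pr_out (suppP x).2 _.
have hy i : i \notin s -> pr M i y = 0.
  rewrite mem_undup mem_cat negb_or => /andP[_].
  exact: pr_out (suppP y).2 _.
rewrite (gsumE F0 us hx) (gsumE F0 us hy) (@gsumE _ F _ s) //; last first.
  by move=> i hi; rewrite linearP hx // hy // scaler0 addr0.
rewrite scaler_sumr -big_split /=; apply: eq_bigr => i _.
by rewrite linearP Fl.
Qed.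

Lemma gsg_homog d i x :
  homog i x -> gsg d x = (-1) ^+ `|(d * i)%R|%N *: x.
Proof. by move=> hx; rewrite /gsg (gsum_homog _ hx) // => j; rewrite scaler0. Qed.

End Components.

Section Shift.
Variables (k : comPzRingType) (M : gmod k).

Lemma shift_prK (i j : int) (x : M) :
  pr M (i - 1) (pr M (j - 1) x) = if i == j then pr M (j - 1) x else 0.
Proof. by rewrite prK (inj_eq (addIr _)). Qed.

Lemma shift_pr_sum (x : M) :
  exists2 s : seq int, uniq s & x = \sum_(i <- s) pr M (i - 1) x.
Proof.
exists [seq i + 1 | i <- supp x].
  by rewrite (map_inj_uniq (addIr _)); case: (suppP x).
rewrite big_map {1}(suppP x).2; apply: eq_bigr => i _; by rewrite addrK.
Qed.

(* Same carrier, so that the degree one map s is the identity function. *)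
Definition shift : gmod k :=
  @Gmod k M (fun i => pr M (i - 1)) shift_prK shift_pr_sum.

End Shift.

Section gHom.
Variables (k : comPzRingType) (M N : gmod k).

(* f is linear and has only finitely many nonzero components, i.e. it lies in
   the direct sum over n of the products over i of Hom(M_i, N_(i+n)). *)
Definition is_hom (f : M -> N) : Prop :=
  linear f /\ exists s : seq int, forall n, n \notin s ->
    forall i x, pr N (i + n) (f (pr M i x)) = 0.

Definition hom_pred : {pred M -> N} := fun f => `[< is_hom f >].

Lemma hom_pred_submod : submod_closed hom_pred.
Proof.
split=> [|a f g].
  apply/asboolP; split.
    by move=> a x y; change (0 = a *: 0 + 0 :> N); rewrite scaler0 addr0.
  by exists [::] => n _ i x; change (pr N (i + n) 0 = 0); rewrite raddf0.
move=> /asboolP[fl [s hs]] /asboolP[gl [t ht]]; apply/asboolP; split.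
  move=> b x y.
  change (a *: f (b *: x + y) + g (b *: x + y)
          = b *: (a *: f x + g x) + (a *: f y + g y)).
  rewrite fl gl !scalerDr !scalerA mulrC.
  by rewrite !addrA; congr (_ + _); rewrite -!addrA; congr (_ + _); rewrite addrC.
exists (s ++ t) => n; rewrite mem_cat negb_or => /andP[ns nt] i x.
change (pr N (i + n) (a *: f (pr M i x) + g (pr M i x)) = 0).
by rewrite linearP hs // ht // scaler0 addr0.
Qed.

HB.instance Definition _ :=
  GRing.isSubmodClosed.Build k (M -> N) hom_pred hom_pred_submod.

Record ghom := MkGhom { hom_fun :> M -> N; _ : hom_fun \in hom_pred }.

HB.instance Definition _ := [isSub for hom_fun].
HB.instance Definition _ := [Choice of ghom by <:].
HB.instance Definition _ := [SubChoice_isSubLmodule of ghom by <:].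

Lemma homP (f : ghom) : is_hom f.
Proof. by case: f => f /= /asboolP. Qed.

Lemma hom_linear (f : ghom) : linear f.
Proof. by case: (homP f). Qed.

HB.instance Definition _ (f : ghom) :=
  GRing.isLinear.Build k M N *:%R (hom_fun f) (@hom_linear f).

Lemma hom_ext (f g : ghom) : (forall x, f x = g x) -> f = g.
Proof. by move=> fg; apply: val_inj; apply/funext. Qed.

Lemma hom0E x : (0 : ghom) x = 0.
Proof. by []. Qed.

Lemma homDE (f g : ghom) x : (f + g) x = f x + g x.
Proof. by []. Qed.

Lemma homNE (f : ghom) x : (- f) x = - f x.
Proof. by []. Qed.

Lemma homZE a (f : ghom) x : (a *: f) x = a *: f x.
Proof. by []. Qed.

(* [deg_map n] is the product over i of Hom(M_i, N_(i+n)). *)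
Definition deg_map (n : int) (f : M -> N) : Prop :=
  linear f /\ forall i x, homog i x -> homog (i + n) (f x).

Lemma deg_map_hom n f : deg_map n f -> f \in hom_pred.
Proof.
move=> [fl fd]; apply/asboolP; split=> //; exists [:: n] => m.
rewrite inE => mn i x; apply: pr_neq (fd _ _ (pr_homog i x)).
by rewrite (inj_eq (addrI _)).
Qed.

Definition hpr_fun (n : int) (f : M -> N) : M -> N :=
  gsum (fun i y => pr N (i + n) (f y)).

Lemma hpr_fun_homog n (f : ghom) i x :
  homog i x -> hpr_fun n f x = pr N (i + n) (f x).
Proof.
by move=> hx; rewrite /hpr_fun (gsum_homog _ hx) // => j; rewrite !raddf0.
Qed.

Lemma hpr_deg n (f : ghom) : deg_map n (hpr_fun n f).
Proof.
split=> [|i x hx]; first by apply: gsum_linear => i a x y; rewrite !linearP.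
by rewrite (hpr_fun_homog _ _ hx); apply: pr_homog.
Qed.

Definition hpr (n : int) (f : ghom) : ghom := MkGhom (deg_map_hom (hpr_deg n f)).

Lemma hprE n (f : ghom) i x : homog i x -> hpr n f x = pr N (i + n) (f x).
Proof. exact: hpr_fun_homog. Qed.

Lemma hom_ext_homog (f g : ghom) :
  (forall i x, homog i x -> f x = g x) -> f = g.
Proof.
move=> fg; apply: hom_ext => x; rewrite (suppP x).2 !raddf_sum.
by apply: eq_bigr => i _; apply/fg/pr_homog.
Qed.

Lemma hpr_linear n : linear (hpr n).
Proof.
move=> a f g; apply: hom_ext_homog => i x hx.
by rewrite homDE homZE (hprE n _ hx) (hprE n f hx) (hprE n g hx) homDE homZE linearP.
Qed.

HB.instance Definition _ n :=
  GRing.isLinear.Build k ghom ghom *:%R (hpr n) (@hpr_linear n).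

Lemma hprK i j (f : ghom) : hpr i (hpr j f) = if i == j then hpr j f else 0.
Proof.
apply: hom_ext_homog => l x hx; rewrite (hprE i _ hx) (hprE j _ hx) prK (inj_eq (addrI _)).
by case: eqP => // _; rewrite (hprE j _ hx).
Qed.

Lemma hpr_sum (f : ghom) :
  exists2 s : seq int, uniq s & f = \sum_(i <- s) hpr i f.
Proof.
case: (homP f) => _ [s hs]; exists (undup s); first exact: undup_uniq.
apply: hom_ext_homog => i x hx.
have -> : (\sum_(j <- undup s) hpr j f) x = \sum_(j <- undup s) hpr j f x.
  by elim: (undup s) => [|j t IH]; rewrite ?big_nil // !big_cons homDE IH.
rewrite (eq_bigr _ (fun j _ => hprE j f hx)) -[LHS]gsum_pr.
rewrite (@gsumE _ _ _ (fun _ => id) _ [seq i + j | j <- undup s]) ?big_map //.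
  by rewrite (map_inj_uniq (addrI _)) undup_uniq.
move=> j hj; rewrite -(subrKC i j) -hx; apply: hs; rewrite -mem_undup.
apply: contra hj => h; apply/mapP; exists (j - i) => //; by rewrite addrC subrK.
Qed.

Definition gHom : gmod k := @Gmod k ghom hpr hprK hpr_sum.

Lemma homog_homP n (f : ghom) :
  @homog k gHom n f <-> forall i x, homog i x -> homog (i + n) (f x).
Proof.
split=> [<- i x hx | h]; first exact: (hpr_deg n f).2.
apply: hom_ext_homog => i x hx.
exact: (etrans (hprE n f hx) (h i x hx)).
Qed.

(* The element of gHom M N given by a function (zero if the function does not
   belong to gHom M N). *)
Definition to_hom (f : M -> N) : ghom := insubd 0 f.

Lemma to_homE n f : deg_map n f -> to_hom f = f :> (M -> N).
Proof. by move=> fd; rewrite /to_hom insubdK //; apply: deg_map_hom fd. Qed.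

End gHom.

Section Composition.
Variables (k : comPzRingType) (M N P : gmod k).

Lemma comp_hom (g : ghom N P) (f : ghom M N) : g \o f \in @hom_pred k M P.
Proof.
have [_ [t ht]] := homP g; have [_ [s hs]] := homP f.
apply/asboolP; split=> [a x y|]; first by rewrite /= !linearP.
exists [seq a + b | a <- s, b <- t] => n hn i x /=.
rewrite -[f _]gsum_pr.
rewrite (@gsumE _ _ _ (fun _ => id) _ [seq i + j | j <- undup s]); first last.
- move=> j hj; rewrite -(subrKC i j); apply: hs; rewrite -mem_undup.
  apply: contra hj => h; apply/mapP; exists (j - i) => //.
  by rewrite addrC subrK.
- by rewrite (map_inj_uniq (addrI _)) undup_uniq.
- by [].
rewrite big_map !raddf_sum big_seq; apply: big1 => j; rewrite mem_undup => js.
have -> : i + n = i + j + (n - j) by rewrite -addrA subrKC.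
apply: ht; apply: contra hn => h; apply/allpairsP; exists (j, n - j) => /=.
by split=> //; rewrite subrKC.
Qed.

Definition gcomp (g : ghom N P) (f : ghom M N) : ghom M P :=
  MkGhom (comp_hom g f).

(* (s gamma (s^-1 (x) s^-1))([g] (x) [f]), gamma being composition: by the
   sign rule, moving the second s^-1 past [g] contributes (-1)^|[g]|, where
   |[g]| is the degree in Pi Hom(N, P). *)
Definition sgamma (g : ghom N P) (f : ghom M N) : ghom M P :=
  gcomp (@gsg k (shift (gHom N P)) (-1) g) f.

End Composition.

Section Identity.
Variables (k : comPzRingType) (M : gmod k).

Lemma id_hom : id \in @hom_pred k M M.
Proof. by apply: (@deg_map_hom _ _ _ 0); split=> // i x; rewrite addr0. Qed.

Definition gid : ghom M M := MkGhom id_hom.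

End Identity.

Section Complexes.
Variable k : comPzRingType.

Definition is_diff (M : gmod k) (d : ghom M M) : Prop :=
  @homog k (gHom M M) (-1) d /\ forall x, d (d x) = 0.

Definition chain_map (M N : gmod k) (dM : ghom M M) (dN : ghom N N)
    (f : ghom M N) : Prop :=
  @homog k (gHom M N) 0 f /\ forall x, f (dM x) = dN (f x).

(* f |-> dN f - (-1)^|f| f dM *)
Definition delta_Hom (M N : gmod k) (dM : ghom M M) (dN : ghom N N)
    (f : ghom M N) : ghom M N :=
  gcomp dN f - gcomp (@gsg k (gHom M N) 1 f) dM.

(* For every n, the map induced by f from H_n(X, dX) to H_n(Y, dY) is
   injective and surjective. *)
Definition quasi_iso (X Y : gmod k) (dX : X -> X) (dY : Y -> Y) (f : X -> Y)
    : Prop :=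
  forall n : int,
    (forall x, homog n x -> dX x = 0 ->
       (exists2 y, homog (n + 1) y & f x = dY y) ->
       exists2 z, homog (n + 1) z & x = dX z) /\
    (forall y, homog n y -> dY y = 0 ->
       exists x z, [/\ homog n x, dX x = 0, homog (n + 1) z & y = f x + dY z]).

Definition surj_quasi_iso (X Y : gmod k) (dX : X -> X) (dY : Y -> Y)
    (f : X -> Y) : Prop :=
  (forall y, exists x, f x = y) /\ quasi_iso dX dY f.

Definition semiprojective (P : gmod k) (dP : ghom P P) : Prop :=
  is_diff dP /\
  forall (X Y : gmod k) (dX : ghom X X) (dY : ghom Y Y) (f : ghom X Y),
    is_diff dX -> is_diff dY -> chain_map dX dY f -> surj_quasi_iso dX dY f ->
    @surj_quasi_iso (gHom P X) (gHom P Y)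
      (delta_Hom dP dX) (delta_Hom dP dY) (gcomp f).

Definition surj_semiproj_resolution (G M : gmod k) (dG : ghom G G)
    (dM : ghom M M) (q : ghom G M) : Prop :=
  [/\ semiprojective dG, chain_map dG dM q & surj_quasi_iso dG dM q].

End Complexes.

(* A homogeneous map out of a tensor power of V is identified with the
   corresponding multilinear function; a family (f^l)_l of such maps, one for
   each tensor degree l, is a function on sequences, f^l being its restriction
   to sequences of size l. *)
Section Cochains.
Variable k : comPzRingType.

Definition multilinear (V W : gmod k) (f : seq V -> W) : Prop :=
  forall s1 s2 a x y,
    f (s1 ++ (a *: x + y) :: s2) = a *: f (s1 ++ x :: s2) + f (s1 ++ y :: s2).

Definition has_deg (V W : gmod k) (n : int) (f : seq V -> W) : Prop :=
  forall s : seq (int * V), (forall u, u \in s -> homog u.1 u.2) ->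
    homog (\sum_(u <- s) u.1 + n) (f [seq u.2 | u <- s]).

Definition CCu (A B : gmod k) (n : int) (f : seq A -> B) : Prop :=
  @multilinear (shift A) (shift B) f /\ @has_deg (shift A) (shift B) n f.

Definition CC (A B : gmod k) (n : int) (f : seq A -> B) : Prop :=
  CCu n f /\ f [::] = 0.

Definition tensor_part (A B : gmod k) (l : nat) (f : seq A -> B) (s : seq A)
    : B :=
  if size s == l then f s else 0.

Definition ge1_part (A B : gmod k) (f : seq A -> B) (s : seq A) : B :=
  if s is [::] then 0 else f s.

Definition vanish_on (A B : gmod k) (e : A) (f : seq A -> B) : Prop :=
  forall s1 s2, f (s1 ++ e :: s2) = 0.

(* CC^l(A/ke, B)_n *)
Definition CCbar (A B : gmod k) (e : A) (l : nat) (n : int) (f : seq A -> B)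
    : Prop :=
  [/\ CCu n f, (forall s, size s != l -> f s = 0) & vanish_on e f].

(* mu o nu for nu homogeneous of degree d; applied to x_1, ..., x_l, the map
   1^(x)j (x) nu (x) 1^(x)(i-j-1) gives the sign (-1)^(d(|x_1| + ... + |x_j|)),
   with degrees taken in Pi A. *)
Definition gerst (A B : gmod k) (d : int) (mu : seq A -> B) (nu : seq A -> A)
    (s : seq A) : B :=
  let l := size s in
  \sum_(1 <= i < l.+1) \sum_(0 <= j < i)
    mu (map (@gsg k (shift A) d) (take j s)
        ++ nu (take (l - i).+1 (drop j s)) :: drop (j + (l - i).+1)%N s).

(* nu * alpha, for alpha of degree zero: the sum is over the sequences
   (i_1, ..., i_j) of positive integers with sum l *)
Definition ast (A B : gmod k) (nu : seq B -> B) (alpha : seq A -> B)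
    (s : seq A) : B :=
  let l := size s in
  \sum_(j < l.+1)
    \sum_(t : j.-tuple 'I_l.+1 |
          all (fun i : 'I_l.+1 => 0 < i)%N t
          && (sumn [seq val i | i <- t] == l)%N)
      nu (map alpha (reshape [seq val i | i <- t] s)).

(* alpha star beta for beta homogeneous of degree b *)
Definition star (A M N P : gmod k) (b : int) (alpha : seq A -> ghom N P)
    (beta : seq A -> ghom M N) (s : seq A) : ghom M P :=
  \sum_(0 <= j < (size s).+1)
    sgamma (alpha (map (@gsg k (shift A) b) (take j s))) (beta (drop j s)).

End Cochains.

Section Algebras.
Variable k : comPzRingType.

Definition is_ainf (A : gmod k) (nu : seq A -> A) : Prop :=
  CC (-1) nu /\ forall s, gerst (-1) nu nu s = 0.

Definition is_ainf_mor (A B : gmod k) (nuA : seq A -> A) (nuB : seq B -> B)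
    (alpha : seq A -> B) : Prop :=
  CC 0 alpha /\ forall s, ast nuB alpha s = gerst (-1) alpha nuA s.

Definition su_structure (A : gmod k) (e : A) (nu : seq A -> A) : Prop :=
  (forall i a, homog i a ->
     nu [:: e; a] = a /\ a = (-1) ^+ `|i|%N *: nu [:: a; e]) /\
  (forall s1 s2, size (s1 ++ e :: s2) != 2 -> nu (s1 ++ e :: s2) = 0).

Definition su_mor (A B : gmod k) (eA : A) (eB : B) (alpha : seq A -> B)
    : Prop :=
  alpha [:: eA] = eB /\
  (forall s1 s2, (2 <= size (s1 ++ eA :: s2))%N -> alpha (s1 ++ eA :: s2) = 0).

(* sigma is the fixed splitting A -> k, as a map of graded modules. *)
Definition split_element (A : gmod k) (e : A) (sigma : {scalar A}) : Prop :=
  [/\ homog 0 e, injective (fun c : k => c *: e), sigma e = 1 &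
      forall i x, i != 0 -> homog i x -> sigma x = 0].

Definition ainf_split_unit (A : gmod k) (e : A) (sigma : {scalar A})
    (nu : seq A -> A) : Prop :=
  [/\ split_element e sigma, is_ainf nu & su_structure e nu].

(* The differential nu^1 of Pi A *)
Definition nu1 (A : gmod k) (nu : seq A -> A) : ghom (shift A) (shift A) :=
  @to_hom k (shift A) (shift A) (fun x => nu [:: x]).

Lemma nu1E (A : gmod k) (nu : seq A -> A) :
  is_ainf nu -> forall x, nu1 nu x = nu [:: x].
Proof.
move=> [[[nul nud] _] _] x; rewrite /nu1 (@to_homE _ _ _ (-1)) //.
split=> [a y z|i y hy]; first exact: (nul [::] [::]).
have := nud [:: (i, y)]; rewrite /= big_seq1; apply=> u.
by rewrite inE => /eqP ->.
Qed.

End Algebras.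

Section Modules.
Variable k : comPzRingType.

(* The A_oo-structure of End M, for the complex (M, d) *)
Definition nu_End (M : gmod k) (d : ghom M M) (s : seq (ghom M M)) : ghom M M :=
  match s with
  | [:: x] => - delta_Hom d d x
  | [:: x; y] => - sgamma x y
  | _ => 0
  end.

Variables (A : gmod k) (e : A) (nu : seq A -> A).

Definition is_module (M : gmod k) (p : seq A -> ghom M M) : Prop :=
  [/\ @CCu k A (gHom M M) 0 p, is_diff (p [::]) &
      @is_ainf_mor k A (gHom M M) nu (nu_End (p [::]))
        (@ge1_part k A (gHom M M) p)].

Definition is_su_module (M : gmod k) (p : seq A -> ghom M M) : Prop :=
  is_module p /\ @su_mor k A (gHom M M) e (gid M) (@ge1_part k A (gHom M M) p).

Definition is_mod_mor (M N : gmod k) (pM : seq A -> ghom M M)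
    (pN : seq A -> ghom N N) (f : seq A -> ghom M N) : Prop :=
  @CCu k A (gHom M N) 1 f /\
  forall s, star 1 pN f s
            - @gerst k A (gHom M N) (-1) (@ge1_part k A (gHom M N) f) nu s
            + star 0 f pM s = 0.

Definition is_su_mod_mor (M N : gmod k) (pM : seq A -> ghom M M)
    (pN : seq A -> ghom N N) (f : seq A -> ghom M N) : Prop :=
  is_mod_mor pM pN f /\ @vanish_on k A (gHom M N) e f.

(* The element s q of tensor degree 0 *)
Definition strict (M N : gmod k) (q : ghom M N) (s : seq A) : ghom M N :=
  if s is [::] then q else 0.

(* The composite of f followed by g; f has degree 1. *)
Definition mod_comp (M N P : gmod k) (g : seq A -> ghom N P)
    (f : seq A -> ghom M N) : seq A -> ghom M P :=
  star 1 g f.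

Definition is_homotopy (M N : gmod k) (pM : seq A -> ghom M M)
    (pN : seq A -> ghom N N) (f g r : seq A -> ghom M N) : Prop :=
  @CCu k A (gHom M N) 2 r /\
  forall s, f s - g s =
            @gerst k A (gHom M N) (-1) (@ge1_part k A (gHom M N) r) nu s
            + star 2 pN r s + star 0 r pM s.

Definition su_homotopic (M N : gmod k) (pM : seq A -> ghom M M)
    (pN : seq A -> ghom N N) (f g : seq A -> ghom M N) : Prop :=
  exists r, is_homotopy pM pN f g r /\ @vanish_on k A (gHom M N) e r.

Definition su_homotopy_equivalent (M N : gmod k) (pM : seq A -> ghom M M)
    (pN : seq A -> ghom N N) : Prop :=
  exists (f : seq A -> ghom M N) (g : seq A -> ghom N M),
    [/\ is_su_mod_mor pM pN f, is_su_mod_mor pN pM g,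
        su_homotopic pM pM (mod_comp g f) (strict (gid M)) &
        su_homotopic pN pN (mod_comp f g) (strict (gid N))].

(* The differential of CC(A/ke, Hom(N, G)) on an element f of degree i, with
   dN and dG the differentials of N and G; f o nu^1 is the composite of f with
   the tensor product differential induced by nu^1. *)
Definition d_AHom (N G : gmod k) (dN : ghom N N) (dG : ghom G G) (i : int)
    (f : seq A -> ghom N G) (s : seq A) : ghom N G :=
  - delta_Hom dN dG (f s)
  - (-1) ^+ `|i|%N *: @gerst k A (gHom N G) (-1) f (tensor_part 1 nu) s.

(* H_i(CC^n(A/ke, Hom(N, G)), d_AHom) = 0 *)
Definition H_CCbar_vanishes (N G : gmod k) (dN : ghom N N) (dG : ghom G G)
    (n : nat) (i : int) : Prop :=
  forall f : seq A -> ghom N G, @CCbar k A (gHom N G) e n i f ->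
    (forall s, d_AHom dN dG i f s = 0) ->
    exists r : seq A -> ghom N G, @CCbar k A (gHom N G) e n (i + 1) r /\
      forall s, d_AHom dN dG (i + 1) r s = f s.

End Modules.

(* Main.v *)
From HB Require Import structures.
Require Import Defs.
From mathcomp Require Import all_boot all_algebra.
From mathcomp Require Import boolp.
Set Implicit Arguments.
Unset Strict Implicit.
Unset Printing Implicit Defensive.
Import GRing.Theory.
Local Open Scope ring_scope.

(** Let T be the sign x |-> (-1)^|x| x of the bar degree. Once a cochain with
    values in Hom(M, N) is given its degree as a map into Hom(M, N) itself, not
    the suspension, the signs of the theory that depend on arguments are
    applications of T to these arguments, and the calculus of cochains consists
    of identities between sums over the cuttings of a sequence. Write f g for the
    cup product, f nu for the insertion of the operations of A into f, and
    D f = pN f - (-1)^|f| (f pM + f nu).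
    A strictly unital module structure is a unital cochain p of degree -1 whose
    curvature p p + p nu vanishes, a morphism is a cochain of degree 0 with
    D f = 0, and a homotopy from f to g is a cochain r of degree 1 with
    D r = f - g. One has D D = 0 (total_diffK), and D preserves the cochains
    vanishing on the unit (total_diff_unit).

    A surjective quasi-isomorphism of complexes X -> Y has a strict lifting
    property (fibration): an element y together with a cycle x' lying over its
    boundary lifts to an x over y with boundary x'. Semiprojectivity of N gives
    it to Hom(N, G) -> Hom(N, M). Semiprojectivity of the suspension of A, after
    a correction by a map of rank one along the unit, shows that passing to maps
    from the suspension of A which vanish on the unit preserves it
    (reduced_hom_lift). Currying one argument after another gives it to the
    complexes of reduced cochains of each tensor degree (cochain_lift).

    The leading term of D is the differential of these complexes
    (total_diff_leading). As D D = 0, the errors of a solution up to some tensor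
    degree satisfy the hypotheses of cochain_lift in the next one, so the map
    induced by q has the lifting property with respect to D (total_lift). Lifting
    a morphism alpha with D f = 0 gives the second part of the theorem, and
    lifting 0 with D r = delta - delta' gives the third.

    The first part is the nonlinear analogue (structure_lift). Starting from the
    differential of G and the unit, the components of p are chosen one after
    another; the error is the curvature, whose leading term is a cycle by the
    Bianchi identity, and whose image under q is, up to sign, the boundary of the
    failure pM q - q p of strictness. Finally, two structures on G are compared by lifting
    q, up to sign, in both directions: the composites and the identities are lifts
    of the same map, hence homotopic. *)

(** * Sums over the cuttings of a sequence, and insertion of an operation *)

Section Splittings.
Variables (A : Type) (V : zmodType).
Implicit Types (K : seq A -> seq A -> V) (s : seq A).

(** Recursion on s, rather than a sum indexed by the length of u, lets the
    identities below be proved by induction without reindexing sums. *)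
Fixpoint split_sum K s : V :=
  if s is x :: s' then K [::] s + split_sum (fun u v => K (x :: u) v) s'
  else K [::] [::].

Lemma eq_split_sum_in K K' s :
  (forall u v, u ++ v = s -> K u v = K' u v) -> split_sum K s = split_sum K' s.
Proof.
elim: s K K' => [|x s IH] K K' h /=; first exact: h.
by rewrite h //; congr (_ + _); apply: IH => u v uv; apply: h; rewrite /= uv.
Qed.

Lemma eq_split_sum K K' s :
  (forall u v, K u v = K' u v) -> split_sum K s = split_sum K' s.
Proof. by move=> h; apply: eq_split_sum_in => u v _; apply: h. Qed.

Lemma split_sum0 K s :
  (forall u v, u ++ v = s -> K u v = 0) -> split_sum K s = 0.
Proof.
elim: s K => [|x s IH] K h /=; first exact: h.
by rewrite h // add0r; apply: IH => u v uv; apply: h; rewrite /= uv.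
Qed.

Lemma split_sumD K K' s :
  split_sum (fun u v => K u v + K' u v) s = split_sum K s + split_sum K' s.
Proof. by elim: s K K' => [|x s IH] K K' //=; rewrite IH addrACA. Qed.

Lemma split_sum_cat K s x t :
  split_sum K (s ++ x :: t) =
  split_sum (fun u v => K u (v ++ x :: t)) s
  + split_sum (fun u v => K (s ++ x :: u) v) t.
Proof.
elim: s K => [|y s IH] K //=.
by rewrite IH addrA.
Qed.

(** Both sides run over the cuttings of s into three pieces. *)
Lemma split_sum_assoc (F : seq A -> seq A -> seq A -> V) s :
  split_sum (fun u t => split_sum (F u) t) s
  = split_sum (fun t w => split_sum (fun u v => F u v w) t) s.
Proof.
elim: s F => [|x s IH] F //=.
by rewrite split_sumD IH addrA.
Qed.

Lemma split_sumE K s :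
  split_sum K s = \sum_(0 <= j < (size s).+1) K (take j s) (drop j s).
Proof.
elim: s K => [|x s IH] K /=; first by rewrite big_nat1.
by rewrite big_nat_recl // IH.
Qed.

End Splittings.

Lemma split_sum_additive (A : Type) (V W : zmodType) (h : V -> W)
    (K : seq A -> seq A -> V) s :
  {morph h : x y / x + y} ->
  h (split_sum K s) = split_sum (fun u v => h (K u v)) s.
Proof. by move=> hD; elim: s K => [|x s IH] K //=; rewrite hD IH. Qed.

Lemma split_sum_map (A B : Type) (V : zmodType) (h : A -> B)
    (K : seq B -> seq B -> V) s :
  split_sum K (map h s) = split_sum (fun u v => K (map h u) (map h v)) s.
Proof. by elim: s K => [|x s IH] K //=; rewrite IH. Qed.

Lemma split_sum_first (A : Type) (V : zmodType) (K : seq A -> seq A -> V) s :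
  (forall x u v, K (x :: u) v = 0) -> split_sum K s = K [::] s.
Proof. by case: s => [|x s] h //=; rewrite split_sum0 ?addr0. Qed.

Lemma split_sum_last (A : Type) (V : zmodType) (K : seq A -> seq A -> V) s :
  (forall x u v, K u (x :: v) = 0) -> split_sum K s = K s [::].
Proof.
by elim: s K => [|x s IH] K h //=; rewrite h add0r IH // => y u v; apply: h.
Qed.

Section Insertion.
Variables (A : Type) (T : A -> A) (nu : seq A -> A).

(** The composite of f with the coderivation determined by nu, that is the
    sum of f (T u ++ nu v :: w) over the cuttings of s into u, v and w with v
    nonempty. T is the sign by which nu, an operation of odd degree, moves past
    u. Peeling off the first element of s, either it starts the block v, or it
    is absorbed into f. *)
Fixpoint insert (V : zmodType) (f : seq A -> V) (s : seq A) : V :=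
  if s is x :: s' then
    split_sum (fun v w => f (nu (x :: v) :: w)) s'
    + insert (fun t => f (T x :: t)) s'
  else 0.

Section Basic.
Variable V : zmodType.
Implicit Types f : seq A -> V.

Lemma eq_insert f g s : (forall t, f t = g t) -> insert f s = insert g s.
Proof. by move=> /funext ->. Qed.

Lemma insert0 s : insert (fun _ => 0 : V) s = 0.
Proof.
elim: s => [|x s IH] //=.
by rewrite IH addr0; apply: split_sum0.
Qed.

Lemma insert_additive (W : zmodType) (h : V -> W) f s :
  {morph h : x y / x + y} -> h (insert f s) = insert (fun t => h (f t)) s.
Proof.
move=> hD; have h0 : h 0 = 0 by apply: (addrI (h 0)); rewrite -hD !addr0.
by elim: s f => [|x s IH] f //=; rewrite hD IH split_sum_additive.
Qed.

Lemma insertD f g s : insert (fun t => f t + g t) s = insert f s + insert g s.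
Proof.
elim: s f g => [|x s IH] f g /=; first by rewrite addr0.
by rewrite split_sumD IH addrACA.
Qed.

Lemma insertN f s : insert (fun t => - f t) s = - insert f s.
Proof. by rewrite (@insert_additive _ -%R) //; apply: opprD. Qed.

(** The Leibniz rule: the block fed to nu lies on one side of the cut. This is
    purely combinatorial; signs enter only through T. *)
Lemma insert_split (K : seq A -> seq A -> V) s :
  insert (split_sum K) s
  = split_sum (fun u v => insert (K^~ v) u) s
    + split_sum (fun u v => insert (K (map T u)) v) s.
Proof.
elim: s K => [|x s IH] K /=; first by rewrite addr0.
rewrite insertD IH !split_sumD split_sum_assoc add0r.
rewrite [insert _ s + (_ + _)]addrCA (addrC (split_sum _ s) (split_sum _ s)).
by rewrite addrACA !addrA.
Qed.

End Basic.

End Insertion.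

Lemma eq_insert_in (A : Type) (V : zmodType) (T : A -> A) (nu nu' : seq A -> A)
    (f g : seq A -> V) s :
  (forall u v w, v <> [::] -> u ++ v ++ w = s ->
     f (map T u ++ nu v :: w) = g (map T u ++ nu' v :: w)) ->
  insert T nu f s = insert T nu' g s.
Proof.
elim: s f g => [|x s IH] f g h //=; congr (_ + _).
  by apply: eq_split_sum_in => v w vw; apply: (h [::] (x :: v) w) => //=; rewrite vw.
by apply: IH => u v w v0 uvw; apply: (h (x :: u)) => //=; rewrite uvw.
Qed.

Lemma insert0_in (A : Type) (V : zmodType) (T : A -> A) (nu : seq A -> A)
    (f : seq A -> V) s :
  (forall u v w, v <> [::] -> u ++ v ++ w = s -> f (map T u ++ nu v :: w) = 0) ->
  insert T nu f s = 0.
Proof. by move=> h; rewrite -(insert0 T nu V s); apply: eq_insert_in. Qed.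

Lemma eq_insert_size (A : Type) (V : zmodType) (T : A -> A) (nu : seq A -> A)
    (f g : seq A -> V) s :
  (forall t, (size t <= size s)%N -> f t = g t) ->
  insert T nu f s = insert T nu g s.
Proof.
move=> fg; apply: eq_insert_in => u [|x v] w // _ uvw; apply: fg.
by rewrite -uvw !size_cat size_map leq_add2l /= ltnS leq_addl.
Qed.

Definition slot_additive (B W : zmodType) (g : seq B -> W) :=
  forall u x y w, g (u ++ (x + y) :: w) = g (u ++ x :: w) + g (u ++ y :: w).

Lemma slot_additive0 (A V : zmodType) (f : seq A -> V) u w :
  slot_additive f -> f (u ++ 0 :: w) = 0.
Proof. by move=> fD; apply: (addrI (f (u ++ 0 :: w))); rewrite -fD !addr0. Qed.

Lemma slot_additiveN (A V : zmodType) (f : seq A -> V) u x w :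
  slot_additive f -> f (u ++ - x :: w) = - f (u ++ x :: w).
Proof.
move=> fD; apply: (addrI (f (u ++ x :: w))).
by rewrite -fD !subrr slot_additive0.
Qed.

Section Square.
Variables (A : zmodType) (T : A -> A) (nu : seq A -> A).
Hypothesis nuT : forall s, nu (map T s) = - T (nu s).

(** As nu is odd, it anticommutes with T. *)
Lemma insert_mapT (V : zmodType) (f : seq A -> V) s :
  slot_additive f ->
  insert T nu (fun t => f (map T t)) s = - insert T nu f (map T s).
Proof.
elim: s f => [|x s IH] f fD /=; first by rewrite oppr0.
rewrite (IH (fun t => f (T (T x) :: t))); last first.
  by move=> u y z w; apply: (fD (T (T x) :: u)).
rewrite opprD; congr (_ + _); rewrite split_sum_map.
rewrite (@split_sum_additive _ _ _ -%R); last exact: opprD.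
apply: eq_split_sum => u v; rewrite -/(map T (x :: u)) nuT.
by rewrite (slot_additiveN [::]) // opprK.
Qed.

Hypothesis nu_additive : slot_additive nu.
Hypothesis nunu : forall s, insert T nu nu s = 0.

(** A coderivation of odd degree squares to the coderivation of its own
    Gerstenhaber square. Two insertions either are nested, and the nested ones
    add up to insertions of the square of nu, or are disjoint, and then cancel
    in pairs by oddness. *)
Lemma insert_insert (V : zmodType) (f : seq A -> V) s :
  slot_additive f -> insert T nu (insert T nu f) s = 0.
Proof.
elim: s f => [|x s IH] f fD //=.
have fD1 w : {morph (fun y => f (y :: w)) : y z / y + z} by move=> y z; apply: (fD [::]).
rewrite insertD split_sumD insert_split split_sum_assoc.
rewrite IH; last by move=> u y z w; apply: (fD [:: T (T x) & u]).
rewrite addr0 addrACA [X in _ + X](_ : _ = 0).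
  (* nested insertions assemble to the square of nu *)
  rewrite addr0 -split_sumD; apply: split_sum0 => u v _ /=.
  rewrite -(@split_sum_additive _ _ _ (fun y => f (y :: v))) //.
  rewrite -(@insert_additive _ _ _ _ _ (fun y => f (y :: v))) // -fD1.
  by rewrite (_ : _ + _ = insert T nu nu (x :: u)) // nunu (slot_additive0 [::]).
(* disjoint insertions occur twice, with opposite signs *)
rewrite -split_sumD; apply: split_sum0 => u v _.
rewrite -insertD -[RHS](insert0 T nu V v); apply: eq_insert => t.
by rewrite -/(map T (x :: u)) nuT (slot_additiveN [::]) // addrN.
Qed.

End Square.

(** * The cup product and the twisted differential *)

(** Proves that a signed sum vanishes by bringing the opposite of its first
    term next to it, over and over. *)
Ltac cancel_opposites :=
  rewrite ?(oppr0, addr0, add0r, opprD, opprK) // -[LHS]addr0 -?addrA;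
  repeat match goal with
  | |- - ?y + _ = 0 => rewrite ?(addrCA _ y) addNKr
  | |- ?y + _ = 0 => rewrite ?(addrCA _ (- y)) addKr
  end.

Ltac zmod_equality :=
  apply/eqP; rewrite -subr_eq0; apply/eqP; cancel_opposites.

Section Composition.
Variables (k : comPzRingType) (M N P Q : gmod k).

Lemma gcompDl (g g' : ghom N P) (f : ghom M N) :
  gcomp (g + g') f = gcomp g f + gcomp g' f.
Proof. exact: hom_ext. Qed.

Lemma gcompDr (g : ghom N P) (f f' : ghom M N) :
  gcomp g (f + f') = gcomp g f + gcomp g f'.
Proof. by apply: hom_ext => x; rewrite /= !raddfD. Qed.

Lemma gcompZl a (g : ghom N P) (f : ghom M N) :
  gcomp (a *: g) f = a *: gcomp g f.
Proof. exact: hom_ext. Qed.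

Lemma gcompZr a (g : ghom N P) (f : ghom M N) :
  gcomp g (a *: f) = a *: gcomp g f.
Proof. by apply: hom_ext => x; rewrite /= !linearZ. Qed.

Lemma gcompNl (g : ghom N P) (f : ghom M N) : gcomp (- g) f = - gcomp g f.
Proof. exact: hom_ext. Qed.

Lemma gcompNr (g : ghom N P) (f : ghom M N) : gcomp g (- f) = - gcomp g f.
Proof. by apply: hom_ext => x; rewrite /= !raddfN. Qed.

Lemma gcomp0l (f : ghom M N) : gcomp (0 : ghom N P) f = 0.
Proof. exact: hom_ext. Qed.

Lemma gcomp0r (g : ghom N P) : gcomp g (0 : ghom M N) = 0.
Proof. by apply: hom_ext => x; rewrite /= raddf0. Qed.

Lemma gcompA (h : ghom P Q) (g : ghom N P) (f : ghom M N) :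
  gcomp h (gcomp g f) = gcomp (gcomp h g) f.
Proof. exact: hom_ext. Qed.

Lemma gcomp1l (f : ghom M N) : gcomp (gid N) f = f.
Proof. exact: hom_ext. Qed.

Lemma gcomp1r (f : ghom M N) : gcomp f (gid M) = f.
Proof. exact: hom_ext. Qed.

End Composition.

Definition twist (A : Type) (T : A -> A) (b : bool) : A -> A :=
  if b then T else id.

Section Cup.
Variables (k : comPzRingType) (A : zmodType) (T : A -> A) (nu : seq A -> A).
Hypothesis TK : involutive T.
Hypothesis nu_additive : slot_additive nu.
Hypothesis nuT : forall s, nu (map T s) = - T (nu s).
Hypothesis nunu : forall s, insert T nu nu s = 0.

Implicit Types M N P Q : gmod k.

Lemma map_twist a b s :
  map (twist T a) (map (twist T b) s) = map (twist T (a (+) b)) s.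
Proof.
by rewrite -map_comp; apply: eq_map => x; case: a; case: b => //=; apply: TK.
Qed.

(** The convolution product of cochains with values in Hom modules. The sign
    (-1)^(|f||u|) of the Koszul rule is obtained by applying T to the entries of
    u when f has odd degree (b being the parity of f), so that no degree occurs
    in the definition. *)
Definition cup M N P b (g : seq A -> ghom N P) (f : seq A -> ghom M N)
    (s : seq A) : ghom M P :=
  split_sum (fun u v => gcomp (g (map (twist T b) u)) (f v)) s.

Lemma eq_cup M N P b (g g' : seq A -> ghom N P) (f f' : seq A -> ghom M N) s :
  (forall t, (size t <= size s)%N -> g t = g' t) ->
  (forall t, (size t <= size s)%N -> f t = f' t) -> cup b g f s = cup b g' f' s.
Proof.
move=> hg hf; apply: eq_split_sum_in => u v uv; move: hg hf.
rewrite -uv size_cat => hg hf.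
by rewrite hg ?hf ?size_map ?leq_addr ?leq_addl.
Qed.

Lemma cupDl M N P b (g g' : seq A -> ghom N P) (f : seq A -> ghom M N) s :
  cup b (fun t => g t + g' t) f s = cup b g f s + cup b g' f s.
Proof. by rewrite -split_sumD; apply: eq_split_sum => u v; apply: gcompDl. Qed.

Lemma cupDr M N P b (g : seq A -> ghom N P) (f f' : seq A -> ghom M N) s :
  cup b g (fun t => f t + f' t) s = cup b g f s + cup b g f' s.
Proof. by rewrite -split_sumD; apply: eq_split_sum => u v; apply: gcompDr. Qed.

Lemma cupZl M N P b a (g : seq A -> ghom N P) (f : seq A -> ghom M N) s :
  cup b (fun t => a *: g t) f s = a *: cup b g f s.
Proof.
rewrite (@split_sum_additive _ _ _ ( *:%R a)); last exact: scalerDr.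
by apply: eq_split_sum => u v; apply: gcompZl.
Qed.

Lemma cupZr M N P b a (g : seq A -> ghom N P) (f : seq A -> ghom M N) s :
  cup b g (fun t => a *: f t) s = a *: cup b g f s.
Proof.
rewrite (@split_sum_additive _ _ _ ( *:%R a)); last exact: scalerDr.
by apply: eq_split_sum => u v; apply: gcompZr.
Qed.

Lemma cupNl M N P b (g : seq A -> ghom N P) (f : seq A -> ghom M N) s :
  cup b (fun t => - g t) f s = - cup b g f s.
Proof.
by rewrite -scaleN1r -cupZl; apply: eq_cup => // t _; rewrite scaleN1r.
Qed.

Lemma cupNr M N P b (g : seq A -> ghom N P) (f : seq A -> ghom M N) s :
  cup b g (fun t => - f t) s = - cup b g f s.
Proof.
by rewrite -scaleN1r -cupZr; apply: eq_cup => // t _; rewrite scaleN1r.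
Qed.

Lemma cupA M N P Q a b (h : seq A -> ghom P Q) (g : seq A -> ghom N P)
    (f : seq A -> ghom M N) s :
  cup b (cup a h g) f s = cup (a (+) b) h (cup b g f) s.
Proof.
rewrite /cup; under [RHS]eq_split_sum => u v.
  rewrite (@split_sum_additive _ _ _ (gcomp _)); last by move=> ? ?; apply: gcompDr.
  under eq_split_sum => v1 v2 do rewrite gcompA.
  over.
rewrite split_sum_assoc; apply: eq_split_sum => u v.
rewrite (@split_sum_additive _ _ _ (fun y => gcomp y _)); last first.
  by move=> ? ?; apply: gcompDl.
by rewrite split_sum_map; apply: eq_split_sum => u1 u2; rewrite map_twist.
Qed.

(** Insertion is a derivation of the cup product. The sign comes from moving
    the twist of the left factor past nu. *)
Lemma insert_cup M N P b (g : seq A -> ghom N P) (f : seq A -> ghom M N) s :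
  slot_additive g ->
  insert T nu (cup b g f) s
  = cup (~~ b) g (insert T nu f) s + (-1) ^+ b *: cup b (insert T nu g) f s.
Proof.
move=> gD; rewrite insert_split addrC; congr (_ + _).
  apply: eq_split_sum => u v; rewrite -[map T u]/(map (twist T true) u).
  rewrite map_twist addbT -(@insert_additive _ _ _ _ _ (gcomp _)) //.
  by move=> ? ?; apply: gcompDr.
rewrite -cupZl; apply: eq_split_sum => u v.
rewrite -(@insert_additive _ _ _ _ _ (fun y => gcomp y _)); last first.
  by move=> ? ?; apply: gcompDl.
case: b; rewrite ?map_id ?scaleN1r ?scale1r.
  by rewrite insert_mapT.
by congr gcomp; apply: eq_insert => t; rewrite map_id.
Qed.

(** The differential f |-> pN f - (-1)^|f| f pM - (-1)^|f| f nu, where b is the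
    parity of |f|. Its cycles in degree 0 are the morphisms of modules, and
    f - g being the differential of r says that r is a homotopy. *)
Definition total_diff M N b (pN : seq A -> ghom N N) (pM : seq A -> ghom M M)
    (f : seq A -> ghom M N) (s : seq A) : ghom M N :=
  cup b pN f s + (-1) ^+ (~~ b) *: (cup true f pM s + insert T nu f s).

(** The failure of p to be a module structure: p is one exactly when this
    vanishes, the component on the empty sequence being the square of the
    differential. *)
Definition curvature M (p : seq A -> ghom M M) (s : seq A) : ghom M M :=
  cup true p p s + insert T nu p s.

(** The two squares pN pN and pM pM cancel against the terms in which nu is
    inserted into pN and pM; the remaining terms cancel by associativity, the
    Leibniz rule and the vanishing of a double insertion. *)
Lemma total_diffK M N b (pN : seq A -> ghom N N) (pM : seq A -> ghom M M)
    (f : seq A -> ghom M N) s :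
  slot_additive pN -> slot_additive f ->
  (forall t, curvature pN t = 0) -> (forall t, curvature pM t = 0) ->
  total_diff (~~ b) pN pM (total_diff b pN pM f) s = 0.
Proof.
move=> pND fD cN cM.
have eN t : cup true pN pN t = - insert T nu pN t.
  by apply/eqP; rewrite -addr_eq0; apply/eqP; apply: cN.
have eM t : insert T nu pM t = - cup true pM pM t.
  by apply/eqP; rewrite -addr_eq0 addrC; apply/eqP; apply: cM.
rewrite /total_diff negbK.
rewrite cupDr cupDl cupZr cupZl insertD.
rewrite -(@insert_additive _ _ _ _ _ ( *:%R _)); last exact: scalerDr.
rewrite cupDr cupDl insertD insert_insert // addr0 !insert_cup //.
rewrite -(@cupA _ _ _ _ true b).
rewrite (@eq_cup _ _ _ b (cup true pN pN) (fun t => - insert T nu pN t) f f) //.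
rewrite cupNl !cupA /= addbT.
rewrite (@eq_cup _ _ _ _ f f (insert T nu pM) (fun t => - cup true pM pM t)) //.
rewrite cupNr; case: b => /=; rewrite !expr1 expr0 !scaleN1r !scale1r !opprD !opprK.
  by cancel_opposites.
by cancel_opposites.
Qed.

Lemma total_diffD M N b (pN : seq A -> ghom N N) (pM : seq A -> ghom M M)
    (f f' : seq A -> ghom M N) s :
  total_diff b pN pM (fun t => f t + f' t) s
  = total_diff b pN pM f s + total_diff b pN pM f' s.
Proof.
rewrite /total_diff cupDr cupDl insertD [in RHS]addrACA -scalerDr.
by congr (_ + _ *: _); rewrite addrACA.
Qed.

Lemma total_diffN M N b (pN : seq A -> ghom N N) (pM : seq A -> ghom M M)
    (f : seq A -> ghom M N) s :
  total_diff b pN pM (fun t => - f t) s = - total_diff b pN pM f s.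
Proof. by rewrite /total_diff cupNr cupNl insertN -opprD scalerN opprD. Qed.

(** The Bianchi identity. It makes the obstruction to extending a partially
    defined module structure a cycle. *)
Lemma bianchi M (p : seq A -> ghom M M) s :
  slot_additive p -> total_diff false p p (curvature p) s = 0.
Proof.
move=> pD; rewrite /total_diff /curvature cupDr cupDl insertD insert_cup //.
rewrite insert_insert // cupA /= !expr1 !scaleN1r addr0 !opprD opprK.
by cancel_opposites.
Qed.

(** The first variation of the curvature is the twisted differential. *)
Lemma curvatureD M (p x : seq A -> ghom M M) s :
  curvature (fun t => p t + x t) s
  = curvature p s + (total_diff true p p x s + cup true x x s).
Proof.
rewrite /total_diff /curvature /= expr0 scale1r cupDl !cupDr insertD.
by zmod_equality.
Qed.

Section StrictMorphism.
Variables (N G M : gmod k) (q : ghom G M).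
Variables (pN : seq A -> ghom N N) (pG : seq A -> ghom G G).
Variable pM : seq A -> ghom M M.

Lemma gcomp_total_diff b (f : seq A -> ghom N G) s :
  (forall t, gcomp q (pG t) = gcomp (pM t) q) ->
  gcomp q (total_diff b pG pN f s)
  = total_diff b pM pN (fun t => gcomp q (f t)) s.
Proof.
move=> hq; rewrite /total_diff gcompDr gcompZr gcompDr; congr (_ + _ *: (_ + _)).
- rewrite /cup (@split_sum_additive _ _ _ (gcomp q)); last exact: gcompDr.
  by apply: eq_split_sum => u v; rewrite !gcompA hq.
- rewrite /cup (@split_sum_additive _ _ _ (gcomp q)); last exact: gcompDr.
  by apply: eq_split_sum => u v; rewrite gcompA.
- by rewrite (@insert_additive _ _ _ _ _ (gcomp q)) //; apply: gcompDr.
Qed.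

(** Relates the obstruction upstairs, pushed forward along q, to the amount
    by which q fails to be a strict morphism; so both can be corrected at
    once. *)
Lemma strictness_defect s :
  (forall t, curvature pM t = 0) ->
  total_diff true pM pG (fun t => gcomp (pM t) q - gcomp q (pG t)) s
  = - gcomp q (curvature pG s).
Proof.
move=> cM; rewrite /total_diff /= expr0 scale1r.
rewrite cupDr cupNr cupDl cupNl insertD insertN /curvature gcompDr opprD.
have e1 : cup true (fun t => gcomp (pM t) q) pG s
    = cup true pM (fun t => gcomp q (pG t)) s.
  by apply: eq_split_sum => u v; rewrite gcompA.
have e2 : cup true (fun t => gcomp q (pG t)) pG s = gcomp q (cup true pG pG s).
  rewrite /cup (@split_sum_additive _ _ _ (gcomp q)); last exact: gcompDr.
  by apply: eq_split_sum => u v; rewrite gcompA.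
have e3 : cup true pM (fun t => gcomp (pM t) q) s = gcomp (cup true pM pM s) q.
  rewrite /cup (@split_sum_additive _ _ _ (fun y => gcomp y q)); last first.
    by move=> ? ?; apply: gcompDl.
  by apply: eq_split_sum => u v; rewrite gcompA.
rewrite e1 e2 e3 -(@insert_additive _ _ _ _ _ (gcomp q)); last exact: gcompDr.
rewrite -(@insert_additive _ _ _ _ _ (fun y => gcomp y q)); last first.
  by move=> ? ?; apply: gcompDl.
have -> : cup true pM pM s = - insert T nu pM s.
  by apply/eqP; rewrite -addr_eq0; apply/eqP; apply: cM.
by rewrite gcompNl; zmod_equality.
Qed.

End StrictMorphism.

Lemma total_diff_cup (M1 M2 M3 : gmod k) (p1 : seq A -> ghom M1 M1)
    (p2 : seq A -> ghom M2 M2) (p3 : seq A -> ghom M3 M3)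
    (g : seq A -> ghom M2 M3) (f : seq A -> ghom M1 M2) s :
  slot_additive g ->
  (forall t, total_diff false p3 p2 g t = 0) ->
  (forall t, total_diff false p2 p1 f t = 0) ->
  total_diff false p3 p1 (cup false g f) s = 0.
Proof.
move=> gD hg hf.
have eg t : cup false p3 g t = cup true g p2 t + insert T nu g t.
  by have /eqP := hg t; rewrite /total_diff /= expr1 scaleN1r subr_eq0 => /eqP.
have ef t : cup false p2 f t = cup true f p1 t + insert T nu f t.
  by have /eqP := hf t; rewrite /total_diff /= expr1 scaleN1r subr_eq0 => /eqP.
rewrite /total_diff /= expr1 scaleN1r insert_cup //= expr0 scale1r.
rewrite -(@cupA _ _ _ _ false false) [cup true (cup _ _ _) _ _]cupA /=.
rewrite (@eq_cup _ _ _ _ (cup false p3 g) _ f f s (fun t _ => eg t)) // cupDl.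
rewrite cupA /= (@eq_cup _ _ _ _ g g (cup false p2 f) _ s _ (fun t _ => ef t)) //.
by rewrite cupDr !opprD; cancel_opposites.
Qed.

End Cup.

(** * Strict units *)

Section Unit.
Variables (A : zmodType) (T : A -> A) (nu : seq A -> A) (e : A).
Hypothesis nu_unitl : forall x, nu [:: e; x] = x.
Hypothesis nu_unitr : forall x, nu [:: x; e] = - T x.
Hypothesis nu_unit : forall u w, size (u ++ e :: w) != 2 -> nu (u ++ e :: w) = 0.
Hypothesis Te : T e = - e.

(** The condition on a strictly unital structure or morphism in tensor degrees
    two and more; in tensor degree one the value at e is prescribed
    separately. *)
Definition vanish_from2 (V : zmodType) (f : seq A -> V) :=
  forall u w, u ++ w <> [::] -> f (u ++ e :: w) = 0.

(** The only surviving insertions multiply e with one of its two neighbours.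
    They give the same value with opposite signs, so what is left are the cases
    in which e has no right or no left neighbour. *)
Lemma insert_unit (V : zmodType) (f : seq A -> V) u w :
  slot_additive f -> vanish_from2 f ->
  insert T nu f (u ++ e :: w)
  = (if nilp w then 0 else f (map T u ++ w))
    - (if nilp u then 0 else f (map T u ++ w)).
Proof.
elim: u f => [|x u IH] f fD fe.
  rewrite subr0 /=; case: w => [|y w] /=.
    by rewrite addr0 (nu_unit (u := [::])) // (slot_additive0 [::]).
  rewrite (nu_unit (u := [::])) // (slot_additive0 [::]) // add0r.
  rewrite split_sum_first => [|z v t]; last first.
    by rewrite (nu_unit (u := [::])) // (slot_additive0 [::]).
  rewrite nu_unitl Te -[RHS]addr0; congr (_ + _).
  rewrite split_sum0 => [|v t _]; last first.
    by rewrite (slot_additiveN [::]) // (fe [::]) ?oppr0.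
  rewrite add0r; apply: insert0_in => v1 v2 v3 _ _.
  rewrite (slot_additiveN [::]) //.
  by rewrite (fe [::]) ?oppr0 // map_cons; case: v1.
have fxD : slot_additive (fun t => f (T x :: t)).
  by move=> v y z t; apply: (fD (T x :: v)).
have fxe : vanish_from2 (fun t => f (T x :: t)).
  by move=> v t _; apply: (fe (T x :: v)).
rewrite /= IH // split_sum_cat /= [split_sum _ u]split_sum0 ?add0r; last first.
  move=> v1 v2 _; have := fe (nu (x :: v1) :: v2) w.
  by rewrite /= => ->.
case: u {IH} => [|y u] /=.
  rewrite subr0 split_sum_first => [|z v t]; last first.
    by rewrite (nu_unit (u := [:: x])) // (slot_additive0 [::]).
  rewrite nu_unitr (slot_additiveN [::]) //.
  by case: w => [|y w] /=; rewrite ?sub0r ?addr0 // addrC.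
rewrite split_sum0 ?add0r // => v t _.
by rewrite (nu_unit (u := x :: y :: u)) ?(slot_additive0 [::]) //= size_cat addnS.
Qed.

(** A factor containing e together with another argument vanishes, so e must
    be alone in its factor. *)
Lemma cup_unit (k : comPzRingType) (M N P : gmod k) b (g : seq A -> ghom N P)
    (f : seq A -> ghom M N) u w :
  slot_additive g -> vanish_from2 g -> vanish_from2 f ->
  cup T b g f (u ++ e :: w)
  = (if nilp w then gcomp (g (map (twist T b) u)) (f [:: e]) else 0)
    + (if nilp u then (-1) ^+ b *: gcomp (g [:: e]) (f w) else 0).
Proof.
move=> gD ge fe; rewrite /cup split_sum_cat.
congr (_ + _).
  case: w => [|y w] /=.
    by rewrite split_sum_last // => x v1 v2; rewrite fe ?gcomp0r // cats0.
  by rewrite split_sum0 // => v1 v2 _; rewrite fe ?gcomp0r //; case: v2.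
have gT v1 v2 : g (map (twist T b) (v1 ++ e :: v2))
    = (-1) ^+ b *: g (map (twist T b) v1 ++ e :: map (twist T b) v2).
  rewrite map_cat map_cons; case: b => /=; rewrite ?scale1r ?scaleN1r //.
  by rewrite Te slot_additiveN.
case: u => [|y u].
  rewrite split_sum_first => [|x v1 v2].
    by rewrite (gT [::] [::]) gcompZl.
  by rewrite (gT [::] (x :: v1)) (ge [::]) // scaler0 gcomp0l.
by rewrite split_sum0 // => v1 v2 _; rewrite gT ge // scaler0 gcomp0l.
Qed.

(** The boundary terms of the insertion cancel against the two products in
    which one factor is p [e], the identity. *)
Lemma curvature_unit (k : comPzRingType) (M : gmod k) (p : seq A -> ghom M M) u w :
  slot_additive p -> vanish_from2 p -> p [:: e] = gid M ->
  curvature T nu p (u ++ e :: w) = 0.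
Proof.
move=> pD pe p1; rewrite /curvature cup_unit // insert_unit // p1.
case: w => [|y w]; case: u => [|x u] /=;
  rewrite ?expr1 ?scaleN1r ?gcomp1l ?gcomp1r ?cats0; by zmod_equality.
Qed.

Lemma total_diff_unit (k : comPzRingType) (M N : gmod k) b
    (pN : seq A -> ghom N N) (pM : seq A -> ghom M M) (f : seq A -> ghom M N) u w :
  slot_additive pN -> vanish_from2 pN -> pN [:: e] = gid N ->
  vanish_from2 pM -> pM [:: e] = gid M ->
  slot_additive f -> (forall v t, f (v ++ e :: t) = 0) ->
  total_diff T nu b pN pM f (u ++ e :: w) = 0.
Proof.
move=> pND pNe pN1 pMe pM1 fD fe.
have fe2 : vanish_from2 f by move=> v t _.
rewrite /total_diff !cup_unit // insert_unit // pN1 pM1.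
rewrite (fe [::] [::]) gcomp0r gcomp0l expr1 gcomp1l gcomp1r.
case: b; case: w => [|y w]; case: u => [|x u] /=;
  rewrite ?expr1 ?expr0 ?scale1r ?scaleN1r ?scaler0 ?oppr0 ?cats0; by zmod_equality.
Qed.

End Unit.

(** * Signs and homogeneous elements *)

Section Parity.

Lemma odd_absz_add (i j : int) : odd `|(i + j)%R|%N = odd `|i|%N (+) odd `|j|%N.
Proof.
have posneg (m n : nat) : odd `|(m%:Z - n%:Z)%R|%N = odd m (+) odd n.
  by case: (leqP m n) => [mn|/ltnW nm]; [rewrite distnEr | rewrite distnEl];
    rewrite // oddB // addbC.
case: i => m; case: j => n.
- by rewrite -PoszD !absz_nat oddD.
- by rewrite NegzE abszN posneg.
- by rewrite NegzE abszN addrC posneg addbC.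
by rewrite !NegzE -opprD -PoszD !abszN !absz_nat oddD.
Qed.

Definition int_sign (R : pzRingType) (i : int) : R := (-1) ^+ `|i|%N.

Lemma int_signD (R : pzRingType) i j :
  int_sign R (i + j) = int_sign R i * int_sign R j.
Proof. by rewrite /int_sign -signr_odd odd_absz_add signr_addb !signr_odd. Qed.

Lemma int_signK (R : pzRingType) i : int_sign R i * int_sign R i = 1.
Proof. by rewrite /int_sign -exprD -signr_odd oddD addbb. Qed.

Lemma int_signN (R : pzRingType) i : int_sign R (- i) = int_sign R i.
Proof. by rewrite /int_sign abszN. Qed.

Lemma int_sign1 (R : pzRingType) : int_sign R 1 = -1.
Proof. exact: expr1. Qed.

End Parity.

Section Homogeneous.
Variables (k : comPzRingType) (M : gmod k).
Implicit Types (x y : M) (i : int).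

Lemma homog0 i : homog i (0 : M).
Proof. exact: raddf0. Qed.

Lemma homogD i x y : homog i x -> homog i y -> homog i (x + y).
Proof. by rewrite /homog raddfD /= => -> ->. Qed.

Lemma homogZ i a x : homog i x -> homog i (a *: x).
Proof. by rewrite /homog linearZ /= => ->. Qed.

Lemma homogN i x : homog i x -> homog i (- x).
Proof. by rewrite /homog raddfN /= => ->. Qed.

(** The involution x |-> (-1)^|x| x. *)
Definition sign_inv : M -> M := gsg 1.

Lemma sign_inv_homog i x : homog i x -> sign_inv x = int_sign k i *: x.
Proof. by move=> hx; rewrite /sign_inv (gsg_homog _ hx) mul1r. Qed.

Lemma gsg_linear d : linear (@gsg k M d).
Proof.
by apply: gsum_linear => i a x y; rewrite scalerDr !scalerA mulrC.
Qed.

Lemma linear_ext (W : lmodType k) (f g : M -> W) :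
  linear f -> linear g -> (forall i x, homog i x -> f x = g x) ->
  forall x, f x = g x.
Proof.
move=> fl gl fg x.
pose F : {linear M -> W} := HB.pack f (GRing.isLinear.Build _ _ _ _ f fl).
pose G : {linear M -> W} := HB.pack g (GRing.isLinear.Build _ _ _ _ g gl).
rewrite -[f x]/(F x) -[g x]/(G x) (suppP x).2 !raddf_sum.
by apply: eq_bigr => i _; apply: fg (pr_homog _ _).
Qed.

Lemma sign_inv_linear : linear sign_inv.
Proof. exact: gsg_linear. Qed.

Lemma gsg_parity d x : gsg d x = if odd `|d|%N then sign_inv x else x.
Proof.
apply: (linear_ext (f := gsg d)
          (g := fun x => if odd `|d|%N then sign_inv x else x)) x => [||i x hx].
- exact: gsg_linear.
- by case: odd => // a x y; rewrite sign_inv_linear.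
rewrite (gsg_homog d hx) (sign_inv_homog hx) /int_sign -signr_odd abszM oddM.
by case: (odd `|d|%N); rewrite ?signr_odd //= expr0 scale1r.
Qed.

Lemma sign_invK : involutive sign_inv.
Proof.
apply: linear_ext => [a x y||i x hx]; rewrite ?sign_inv_linear //.
by rewrite !(sign_inv_homog (i := i)) ?scalerA ?int_signK ?scale1r //;
  apply: homogZ.
Qed.

Lemma sign_invD : {morph sign_inv : x y / x + y}.
Proof. by move=> x y; rewrite -[x]scale1r sign_inv_linear !scale1r. Qed.

Lemma sign_invZ a x : sign_inv (a *: x) = a *: sign_inv x.
Proof.
have s0 : sign_inv 0 = 0 by apply: (addrI (sign_inv 0)); rewrite -sign_invD !addr0.
by rewrite -[a *: x]addr0 sign_inv_linear s0 addr0.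
Qed.

Lemma homog_sign_inv i x : homog i x -> homog i (sign_inv x).
Proof. by move=> hx; rewrite (sign_inv_homog hx); apply: homogZ. Qed.

Fixpoint homog_seq (s : seq M) (i : int) : Prop :=
  if s is x :: s' then exists2 j, homog j x & homog_seq s' (i - j) else i = 0.

Lemma homog_seq_cat s t i j :
  homog_seq s i -> homog_seq t j -> homog_seq (s ++ t) (i + j).
Proof.
elim: s i => [|x s IH] i /=; first by move=> ->; rewrite add0r.
by case=> l hx hs ht; exists l => //; rewrite addrAC; apply: IH.
Qed.

Lemma homog_seq_map s i : homog_seq s i -> homog_seq (map sign_inv s) i.
Proof.
elim: s i => [|x s IH] i //= [j hx hs].
by exists j; [apply: homog_sign_inv | apply: IH].
Qed.

End Homogeneous.

(** * Homogeneous multilinear cochains *)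

Section Cochains.
Variables (k : comPzRingType) (A : gmod k).

(** The sign involution for the degrees of the suspension of A, as a function on
    A itself. Fixing this type keeps the suspension from being applied twice when
    implicit arguments are inferred. *)
Definition bar_sign : A -> A := @sign_inv k (shift A).

Lemma bar_sign_linear a x y : bar_sign (a *: x + y) = a *: bar_sign x + bar_sign y.
Proof. exact: (@sign_inv_linear k (shift A)). Qed.

Lemma bar_sign_homog i x :
  @homog k (shift A) i x -> bar_sign x = int_sign k i *: x.
Proof. exact: (@sign_inv_homog k (shift A)). Qed.

Lemma bar_signK : involutive bar_sign.
Proof. exact: (@sign_invK k (shift A)). Qed.

Lemma homog_seq_bar_sign s i :
  @homog_seq k (shift A) s i -> @homog_seq k (shift A) (map bar_sign s) i.
Proof. exact: (@homog_seq_map k (shift A)). Qed.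

(** Degrees are those of a map from the tensor coalgebra on the suspension of
    A to W, with W not suspended. For W a Hom module a module structure has
    degree -1, a morphism degree 0 and a homotopy degree 1; these are the
    degrees for which composition carries no sign. *)
Definition cochain (W : gmod k) (n : int) (f : seq A -> W) : Prop :=
  @multilinear k (shift A) W f /\
  forall s i, @homog_seq k (shift A) s i -> homog (i + n) (f s).

Lemma has_degP (W : gmod k) n (f : seq A -> W) :
  @has_deg k (shift A) W n f <->
  forall s i, @homog_seq k (shift A) s i -> homog (i + n) (f s).
Proof.
split=> h s.
  move=> i hs.
  have [t ht [<- <-]] : exists2 t : seq (int * shift A),
      (forall u, u \in t -> homog u.1 u.2) &
      [seq u.2 | u <- t] = s /\ \sum_(u <- t) u.1 = i.
    elim: s i hs => [|x s IH] i /=; first by move=> ->; exists [::]; rewrite ?big_nil.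
    case=> j hx /IH [t ht [<- e]]; exists ((j, x) :: t).
      by move=> u; rewrite inE => /orP[/eqP -> //|]; apply: ht.
    by rewrite big_cons e /= addrC subrK.
  exact: h.
move=> hs; apply: h; elim: s hs => [|u s IH] hs /=; first by rewrite big_nil.
exists u.1; first by apply: hs; rewrite inE eqxx.
by rewrite big_cons addrC addKr; apply: IH => v vs; apply: hs; rewrite inE vs orbT.
Qed.

Lemma homog_shift (B : gmod k) i (x : B) : @homog k (shift B) i x <-> homog (i - 1) x.
Proof. by []. Qed.

Lemma CCuP (B : gmod k) n (f : seq A -> B) : CCu n f <-> cochain (n - 1) f.
Proof.
rewrite /CCu /cochain; split=> -[fl fd]; split=> //.
  by move=> s i hs; rewrite addrA; apply: ((@has_degP (shift B) n f).1 fd _ _ hs).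
by apply/has_degP => s i hs; apply/homog_shift; rewrite -addrA; apply: fd.
Qed.

Section Target.
Variable W : gmod k.
Implicit Types f g : seq A -> W.

Lemma cochain0 n : cochain n (fun _ => 0 : W).
Proof.
split=> [s1 s2 a x y|s i _]; last exact: homog0.
by rewrite scaler0 addr0.
Qed.

Lemma cochainD n f g : cochain n f -> cochain n g -> cochain n (fun s => f s + g s).
Proof.
move=> [fl fd] [gl gd]; split=> [s1 s2 a x y|s i hs].
  by rewrite fl gl scalerDr addrACA.
by apply: homogD; [apply: fd | apply: gd].
Qed.

Lemma cochainZ n a f : cochain n f -> cochain n (fun s => a *: f s).
Proof.
move=> [fl fd]; split=> [s1 s2 b x y|s i hs]; last by apply/homogZ/fd.
by rewrite fl scalerDr !scalerA mulrC.
Qed.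

Lemma eq_cochain n f g : (forall s, f s = g s) -> cochain n f -> cochain n g.
Proof. by move=> /funext ->. Qed.

Lemma cochainN n f : cochain n f -> cochain n (fun s => - f s).
Proof.
by move=> /(cochainZ (-1)); apply: eq_cochain => s; rewrite scaleN1r.
Qed.

Lemma cochain_additive n f : cochain n f -> slot_additive f.
Proof. by move=> [fl _] u x y w; have := fl u w 1 x y; rewrite !scale1r. Qed.

Lemma multilinear_split (K : seq A -> seq A -> W) :
  (forall v, @multilinear k (shift A) W (K^~ v)) ->
  (forall u, @multilinear k (shift A) W (K u)) ->
  @multilinear k (shift A) W (split_sum K).
Proof.
move=> K1 K2 s1 s2 a x y; rewrite !split_sum_cat scalerDr addrACA.
rewrite !(@split_sum_additive _ _ _ ( *:%R a)); try exact: scalerDr.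
rewrite -!split_sumD; congr (_ + _); apply: eq_split_sum => u v.
  exact: K2.
exact: K1.
Qed.

Lemma homog_split n (K : seq A -> seq A -> W) s i :
  (forall u v i j, @homog_seq k (shift A) u i -> @homog_seq k (shift A) v j ->
     homog (i + j + n) (K u v)) ->
  @homog_seq k (shift A) s i -> homog (i + n) (split_sum K s).
Proof.
elim: s n K i => [|x s IH] n K i hK /=.
  by move=> ->; rewrite -[0]add0r; apply: hK.
case=> j hx hs; apply: homogD.
  by rewrite -[i]add0r; apply: hK => //; exists j.
rewrite -(subrK j i) -addrA; apply: IH => // u v i1 i2 hu hv.
have -> : i1 + i2 + (j + n) = (i1 + j) + i2 + n by zmod_equality.
by apply: hK => //; exists j; rewrite ?addrK.
Qed.

(** A sequence is replaced, one entry after another, by sequences with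
    homogeneous entries. *)
Lemma multilinear_ext f g :
  @multilinear k (shift A) W f -> @multilinear k (shift A) W g ->
  (forall s i, @homog_seq k (shift A) s i -> f s = g s) -> forall s, f s = g s.
Proof.
move=> fl gl fg s.
have H t i : @homog_seq k (shift A) t i -> f (t ++ s) = g (t ++ s).
  elim: s t i => [|x s IH] t i ht; first by rewrite cats0; apply: fg ht.
  apply: (@linear_ext k (shift A) W (fun x => f (t ++ x :: s)) (fun x => g (t ++ x :: s))).
  - by move=> a y z; apply: fl.
  - by move=> a y z; apply: gl.
  move=> j y hy; rewrite -cat_rcons; apply: IH (i + j) _.
  rewrite -cats1; apply: homog_seq_cat => //=; exists j => //; by rewrite subrr.
exact: H [::] 0 _.
Qed.

Lemma multilinear_scale f u c x w :
  @multilinear k (shift A) W f -> f (u ++ c *: x :: w) = c *: f (u ++ x :: w).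
Proof.
move=> fl; have f0 : f (u ++ 0 :: w) = 0.
  have := fl u w 1 0 0; rewrite !scale1r addr0 => h.
  by apply: (addrI (f (u ++ 0 :: w))); rewrite addr0 -h.
by have := fl u w c x 0; rewrite addr0 f0 addr0.
Qed.

Lemma multilinear_sign f u s i :
  @multilinear k (shift A) W f -> @homog_seq k (shift A) s i ->
  f (u ++ map bar_sign s) = int_sign k i *: f (u ++ s).
Proof.
move=> fl; elim: s u i => [|x s IH] u i /=; first by move=> ->; rewrite scale1r.
case=> j hx hs; rewrite (bar_sign_homog hx) multilinear_scale //.
rewrite -cat_rcons (IH _ _ hs) cat_rcons scalerA -int_signD; congr (int_sign _ _ *: _).
by rewrite addrC subrK.
Qed.

Lemma multilinear_map_sign f :
  @multilinear k (shift A) W f ->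
  @multilinear k (shift A) W (fun s => f (map bar_sign s)).
Proof.
by move=> fl s1 s2 a x y; rewrite !map_cat !map_cons bar_sign_linear fl.
Qed.

(** The sign involution passes through a cochain of degree n. This lets the
    signs of the various products, which refer to degrees of values, be moved to
    the arguments. *)
Lemma cochain_sign n f s :
  cochain n f ->
  f (map bar_sign s) = int_sign k n *: sign_inv (f s).
Proof.
move=> [fl fd]; apply: (multilinear_ext
    (f := fun s => f (map bar_sign s))
    (g := fun s => int_sign k n *: sign_inv (f s))) => [|s1 s2 a x y|t i ht].
- exact: multilinear_map_sign.
- by rewrite fl sign_inv_linear scalerDr !scalerA mulrC.
rewrite (multilinear_sign [::] fl ht) (sign_inv_homog (fd _ _ ht)) scalerA.
by rewrite -int_signD addrCA !int_signD int_signK mulr1.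
Qed.

End Target.
End Cochains.

(** * Degrees of the operations on cochains *)

Section CochainOperations.
Variables (k : comPzRingType) (A : gmod k).
Local Notation T := (@bar_sign k A).

Lemma cochain_cons (W : gmod k) n (f : seq A -> W) i (x : A) :
  @homog k (shift A) i x -> cochain n f -> cochain (i + n) (fun s => f (x :: s)).
Proof.
move=> hx [fl fd]; split=> [s1 s2 a y z|s j hs]; first exact: (fl (x :: s1)).
by rewrite addrA; apply: fd; exists i; rewrite ?addrK.
Qed.

Section Insert.
Variable nu : seq A -> A.
Hypothesis hnu : @cochain k A (shift A) (-1) nu.

Lemma cochain_nuT s : nu (map T s) = - (T (nu s) : A).
Proof. by rewrite (cochain_sign s hnu) int_signN int_sign1 scaleN1r. Qed.

Lemma multilinear_insert (W : gmod k) (f : seq A -> W) :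
  @multilinear k (shift A) W f -> @multilinear k (shift A) W (insert T nu f).
Proof.
have [nul _] := hnu; move=> fl s1; elim: s1 f fl => [|x s1 IH] f fl s2 a y z /=.
  rewrite (@eq_insert _ _ _ _ (fun t => f (T (a *: y + z) :: t))
            (fun t => a *: f (T y :: t) + f (T z :: t))); last first.
    by move=> t; rewrite bar_sign_linear; apply: (fl [::]).
  rewrite insertD -(@insert_additive _ _ _ _ _ ( *:%R a)); last exact: scalerDr.
  rewrite (eq_split_sum (K' := fun v w => a *: f (nu (y :: v) :: w) + f (nu (z :: v) :: w))).
    rewrite split_sumD -(@split_sum_additive _ _ _ ( *:%R a)); last exact: scalerDr.
    by rewrite scalerDr addrACA.
  by move=> v w; rewrite (nul [::]); apply: (fl [::]).
rewrite (IH (fun t => f (T x :: t))); last by move=> u; apply: (fl (_ :: u)).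
rewrite (multilinear_split (K := fun v w => f (nu (x :: v) :: w))).
- by rewrite scalerDr addrACA.
- move=> v u w b p r; rewrite -!cat_cons nul.
  exact: (fl [::]).
- by move=> u v; apply: (fl (_ :: v)).
Qed.

Lemma cochain_insert (W : gmod k) n (f : seq A -> W) :
  cochain n f -> cochain (n - 1) (insert T nu f).
Proof.
move=> hf; split; first by apply: multilinear_insert; case: hf.
have [_ nud] := hnu.
move=> s; elim: s n f hf => [|x s IH] n f hf i /=; first by move=> _; apply: homog0.
case=> j hx hs; apply: homogD.
  rewrite -(subrK j i) -addrA.
  apply: (@homog_split k A W _ (fun v w => f (nu (x :: v) :: w))) hs => u v i1 i2 hu hv.
  have -> : i1 + i2 + (j + (n - 1)) = (i1 + j - 1) + i2 + n.
    by zmod_equality.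
  apply: hf.2; exists (i1 + j - 1); last by rewrite [_ + i2]addrC addrK.
  by apply: nud; exists j; rewrite ?addrK.
rewrite -(subrK j i) -addrA (addrA j); apply: IH hs.
by apply: cochain_cons; first apply: homog_sign_inv.
Qed.

End Insert.

Lemma homog_gcomp (M N P : gmod k) i j (g : ghom N P) (f : ghom M N) :
  @homog k (gHom N P) i g -> @homog k (gHom M N) j f ->
  @homog k (gHom M P) (j + i) (gcomp g f).
Proof.
move=> /homog_homP hg /homog_homP hf; apply/homog_homP => l x hx.
by rewrite addrA; apply/hg/hf.
Qed.

Lemma cochain_cup (M N P : gmod k) b m n (g : seq A -> ghom N P)
    (f : seq A -> ghom M N) :
  @cochain k A (gHom N P) m g -> @cochain k A (gHom M N) n f ->
  @cochain k A (gHom M P) (m + n) (cup T b g f).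
Proof.
move=> [gl gd] [fl fd]; split.
  apply: (@multilinear_split k A (gHom M P)) => [v|u] s1 s2 a x y.
    have -> : twist T b = if b then T else id by [].
    rewrite -gcompZl -gcompDl; congr gcomp; case: b; last by rewrite !map_id gl.
    by rewrite !map_cat !map_cons bar_sign_linear gl.
  by rewrite fl gcompDr gcompZr.
move=> s i; apply: (@homog_split k A (gHom M P)) => u v i1 i2 hu hv.
have -> : i1 + i2 + (m + n) = (i2 + n) + (i1 + m) by zmod_equality.
apply: homog_gcomp; last exact: fd.
by apply: gd; case: b; rewrite ?map_id //; apply: homog_seq_bar_sign.
Qed.

Lemma cochain_total_diff (nu : seq A -> A) (M N : gmod k) b n
   (pN : seq A -> ghom N N) (pM : seq A -> ghom M M) (f : seq A -> ghom M N) :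
  @cochain k A (shift A) (-1) nu ->
  @cochain k A (gHom N N) (-1) pN -> @cochain k A (gHom M M) (-1) pM ->
  @cochain k A (gHom M N) n f ->
  @cochain k A (gHom M N) (n - 1) (total_diff T nu b pN pM f).
Proof.
move=> hnu hN hM hf; apply: (@cochainD k A (gHom M N)).
  by rewrite addrC; apply: cochain_cup.
apply: (@cochainZ k A (gHom M N)); apply: (@cochainD k A (gHom M N)).
  exact: cochain_cup.
exact: (@cochain_insert _ hnu (gHom M N)).
Qed.

Lemma cochain_curvature (nu : seq A -> A) (M : gmod k) (p : seq A -> ghom M M) :
  @cochain k A (shift A) (-1) nu -> @cochain k A (gHom M M) (-1) p ->
  @cochain k A (gHom M M) (-1 - 1) (curvature T nu p).
Proof.
move=> hnu hp; apply: (@cochainD k A (gHom M M)); first exact: cochain_cup.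
exact: (@cochain_insert _ hnu (gHom M M)).
Qed.

End CochainOperations.

(** * The Gerstenhaber, star and composition products as cup products *)

Section Translation.
Variables (k : comPzRingType) (A : gmod k).
Local Notation T := (@bar_sign k A).

Lemma int_sign_swap (V : lmodType k) n (x y : V) :
  x = int_sign k n *: y -> y = int_sign k n *: x.
Proof. by move=> ->; rewrite scalerA int_signK scale1r. Qed.

Lemma gsg_bar d : @gsg k (shift A) d = twist T (odd `|d|%N).
Proof. by apply/funext => x; rewrite gsg_parity /twist; case: odd. Qed.

Lemma CCu_shift (B : gmod k) n (f : seq A -> B) :
  CCu n f <-> @cochain k A (shift B) n f.
Proof. by split=> -[fl fd]; split=> //; apply/has_degP. Qed.

Lemma gerst_insert (B : gmod k) (mu : seq A -> B) (nu : seq A -> A) s :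
  gerst (-1) mu nu s = insert T nu mu s.
Proof.
rewrite /gerst gsg_bar /=; elim: s mu => [|x s IH] mu; first by rewrite big_geq.
rewrite /= -IH split_sumE.
under eq_big_nat => i /andP[i1 _] do rewrite big_ltn //.
rewrite big_split /=; congr (_ + _).
  rewrite big_nat_rev /= big_add1 /=.
  apply: eq_big_nat => i /andP[_ hi].
  have -> : ((size s).+1 - (1 + (size s).+2 - i.+2) = i)%N; last by [].
  by rewrite add1n !subSS subKn // ltnW.
rewrite big_ltn // big_geq // add0r big_add1 /=; apply: eq_bigr => i _.
by rewrite big_add1.
Qed.

(** The sign of s gamma (s^-1 (x) s^-1) depends on the degree of the value of
    the left factor; moved to the arguments it becomes one more twist and the
    global sign (-1)^n. *)
Lemma star_cup (M N P : gmod k) b n (g : seq A -> ghom N P)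
    (f : seq A -> ghom M N) s :
  @CCu k A (gHom N P) n g ->
  star b g f s = int_sign k n *: cup T (~~ odd `|b|%N) g f s.
Proof.
move=> /CCu_shift hg; rewrite /star gsg_bar /cup split_sumE scaler_sumr.
apply: eq_bigr => j _; rewrite /sgamma -gcompZl; congr gcomp.
rewrite gsg_parity /=.
have := cochain_sign (map (twist T (odd `|b|%N)) (take j s)) hg.
rewrite -[map T]/(map (twist T true)) map_twist; last exact: bar_signK.
by rewrite addTb; apply: int_sign_swap.
Qed.

Lemma delta_Hom_sign (X Y : gmod k) (dX : ghom X X) (dY : ghom Y Y) (h : ghom X Y) :
  delta_Hom dX dY h = gcomp dY h - gcomp (@sign_inv k (gHom X Y) h) dX.
Proof. by []. Qed.

Lemma ge1_part_nonempty (B : gmod k) (f : seq A -> B) (t : seq A) :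
  t <> [::] -> ge1_part f t = f t.
Proof. by case: t. Qed.

(** The endomorphism algebra has operations of arity one and two only. The unary
    one is the commutator with the differential and gives the two extreme terms
    of the cup product; the binary one gives the others. *)
Lemma ast_cup (M : gmod k) (p : seq A -> ghom M M) s :
  @cochain k A (gHom M M) (-1) p -> s <> [::] ->
  @ast k A (gHom M M) (nu_End (p [::])) (@ge1_part k A (gHom M M) p) s
  = - cup T true p p s.
Proof.
move=> hp s0; rewrite /ast.
have hp' : @cochain k A (shift (gHom M M)) 0 p.
  by apply/CCu_shift/CCuP; rewrite sub0r.
have l0 : (0 < size s)%N by case: (s) s0.
set l := size s in l0 *.
pose F (j : nat) : ghom M M := \sum_(t : j.-tuple 'I_l.+1 |
  all (fun i : 'I_l.+1 => 0 < i)%N t && (sumn [seq val i | i <- t] == l)%N)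
  nu_End (p [::]) (map (@ge1_part k A (gHom M M) p) (reshape [seq val i | i <- t] s)).
have F0 : F 0%N = 0.
  apply: big1 => t _; by rewrite (tuple0 t).
(* the endomorphism algebra has no operation of arity three or more *)
have F3 j : F j.+3 = 0.
  apply: big1 => t _; case/tupleP: t => a t; case/tupleP: t => b t.
  by case/tupleP: t => c t.
have F1 : F 1%N = - delta_Hom (p [::]) (p [::]) (p s).
  rewrite /F (reindex_onto (fun x : 'I_l.+1 => [tuple x]) (fun t => thead t)) /=; last first.
    by move=> t _; case/tupleP: t => a t; apply/val_inj => /=; rewrite (tuple0 t).
  rewrite (big_pred1 ord_max) => [|x /=].
    by rewrite /= take_size ge1_part_nonempty.
  rewrite theadE eqxx !andbT addn0 -val_eqE /=.
  by case: eqP => [->|_]; rewrite ?l0 ?andbF.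
have F2 : F 2%N = - \sum_(1 <= j < l) gcomp (p (map T (take j s))) (p (drop j s)).
  rewrite /F (reindex_onto (fun x : 'I_l.+1 * 'I_l.+1 => [tuple x.1; x.2])
     (fun t => (thead t, thead [tuple of behead t]))) /=; last first.
    move=> t _; case/tupleP: t => a t; case/tupleP: t => b t.
    by apply/val_inj => /=; rewrite (tuple0 t).
  rewrite (reindex_onto (fun x : 'I_l.+1 => (x, rev_ord x)) fst) /=; last first.
    move=> [a b] /=; rewrite addn0 => /andP[/andP[_ /eqP ab] _].
    by congr pair; apply/val_inj; rewrite /= subSS -[RHS](addKn a b) ab.
  rewrite -sumrN (big_nat_widenl 1 0) // (big_nat_widen 0 l l.+1) // big_mkord.
  apply: eq_big => [x|x /andP[/andP[/andP[/andP[x0 /andP[xl _]] _] _] _]].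
    rewrite [(_, _) == _](_ : _ = true); last exact/eqP.
    by rewrite [x == x]eqxx !andbT subSS addn0 subn_gt0 subnKC ?eqxx ?andbT // -ltnS.
  rewrite subSS subn_gt0 in xl *.
  rewrite [X in gcomp _ (p X)](_ : _ = take (l - x) (drop x s)); last first.
    by rewrite take_oversize // size_drop.
  rewrite !ge1_part_nonempty.
  - congr (- gcomp _ _); rewrite gsg_parity /=.
    by rewrite (cochain_sign _ hp') /int_sign expr0 scale1r.
  - move=> /(congr1 size); rewrite size_takel ?size_drop //= => /eqP.
    by rewrite subn_eq0 leqNgt xl.
  by move=> /(congr1 size); rewrite size_takel ?(ltnW xl) //= => x1; rewrite x1 in x0.
rewrite [LHS](_ : _ = F 1%N + F 2%N); last first.
  transitivity (\sum_(j < l.+1) F j) => //; rewrite -(big_mkord xpredT) /=.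
  case: l l0 F F0 F1 F2 F3 => [|[|l]] // _ F F0 F1 F2 F3.
    by rewrite !big_nat_recl //= big_geq // F0 F2 [in RHS]big_geq // oppr0 add0r.
  rewrite !big_nat_recl //= F0 add0r; congr (_ + _).
  by rewrite big1 ?addr0.
rewrite F1 F2 -opprD; congr (- _).
rewrite /cup split_sumE [in RHS]big_ltn // [in RHS]big_nat_recr //=.
rewrite take0 drop0 take_size drop_size.
rewrite delta_Hom_sign -!addrA; congr (_ + _); rewrite addrC; congr (_ + _).
by rewrite (cochain_sign s hp) int_signN int_sign1 scaleN1r gcompNl.
Qed.

End Translation.

(** * Modules, morphisms and homotopies as solutions of cochain equations *)

Section Modules.
Variables (k : comPzRingType) (A : gmod k) (e : A) (nu : seq A -> A).
Local Notation T := (@bar_sign k A).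

Lemma insert_ge1_part (B : gmod k) (f : seq A -> B) s :
  insert T nu (ge1_part f) s = insert T nu f s.
Proof. by apply: eq_insert_in => u v w _ _; rewrite ge1_part_nonempty //; case: u. Qed.

Lemma CCu_cochain (M N : gmod k) n (f : seq A -> ghom M N) :
  @CCu k A (gHom M N) n f <-> @cochain k A (gHom M N) (n - 1) f.
Proof. exact: (@CCuP k A (gHom M N)). Qed.

Lemma su_moduleP (M : gmod k) (p : seq A -> ghom M M) :
  is_su_module e nu p <->
  [/\ @cochain k A (gHom M M) (-1) p, vanish_from2 e p, p [:: e] = gid M &
      forall s, curvature T nu p s = 0].
Proof.
split=> [[[hp [pd pp] [_ hast]] [pe pe2]] | [hp pe2 pe hc]].
  have hp1 : @cochain k A (gHom M M) (-1) p by rewrite -[-1]add0r; apply/CCu_cochain.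
  split=> // [u w uw|s].
    rewrite -(pe2 u w) ?ge1_part_nonempty //; first by case: u {uw}.
    by case: u uw => [|x u]; case: w => //= *; rewrite ?size_cat ?addnS.
  case: s => [|x s].
    by rewrite /curvature /cup /= addr0; apply: hom_ext => x; apply: pp.
  have := hast (x :: s).
  rewrite (ast_cup hp1) // (@gerst_insert k A (gHom M M)).
  rewrite (@insert_ge1_part (gHom M M)) /curvature => <-; exact: addrN.
have h0 : @CCu k A (gHom M M) 0 p by apply/CCu_cochain; rewrite sub0r.
have hd : is_diff (p [::]).
  split; first by rewrite -[-1]add0r; apply: hp.2.
  move=> x; have := hc [::]; rewrite /curvature /cup /= addr0.
  by move=> /(congr1 (fun f : ghom M M => f x)).
split; last first.
  split=> // s1 s2; case: s1 => [|x s1] /= hs; first by apply: (pe2 [::]); case: s2 hs.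
  exact: (pe2 (x :: s1)).
split=> //; split.
  have [hl hdg] := h0.
  split=> //; split=> [s1 s2 a x y|[|u s] hs].
  - by case: s1 => [|z s1]; [apply: (hl [::]) | apply: (hl (z :: s1))].
  - exact: homog0.
  exact: hdg (u :: s) hs.
move=> [|x s].
  rewrite /ast /= big_ord_recl big_ord0 addr0 /gerst big_geq //.
  by apply: big1 => t _; rewrite (tuple0 t).
rewrite (ast_cup hp) // (@gerst_insert k A (gHom M M)).
rewrite (@insert_ge1_part (gHom M M)).
apply/eqP; rewrite eq_sym -addr_eq0 addrC; apply/eqP; exact: (hc (x :: s)).
Qed.

Lemma mod_morP (M N : gmod k) (pM : seq A -> ghom M M) (pN : seq A -> ghom N N)
    (f : seq A -> ghom M N) :
  @cochain k A (gHom N N) (-1) pN ->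
  is_mod_mor nu pM pN f <->
  @cochain k A (gHom M N) 0 f /\ forall s, total_diff T nu false pN pM f s = 0.
Proof.
move=> hN; have hN0 : @CCu k A (gHom N N) 0 pN by apply/CCu_cochain; rewrite sub0r.
have e1 s (hf : @CCu k A (gHom M N) 1 f) : star 1 pN f s
            - @gerst k A (gHom M N) (-1) (@ge1_part k A (gHom M N) f) nu s
            + star 0 f pM s = total_diff T nu false pN pM f s.
  rewrite (star_cup _ _ _ hN0) (star_cup _ _ _ hf) int_sign1 /int_sign expr0 scale1r.
  rewrite (@gerst_insert k A (gHom M N)) (@insert_ge1_part (gHom M N)) scaleN1r.
  by rewrite /total_diff /= expr1 scaleN1r opprD -addrA [- insert _ _ _ _ + _]addrC.
have hP : @CCu k A (gHom M N) 1 f <-> @cochain k A (gHom M N) 0 f.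
  exact: (CCu_cochain 1 f).
split=> -[hf h]; split; first exact/hP.
- by move=> s; rewrite -e1.
- exact/hP.
by move=> s; rewrite e1 //; apply/hP.
Qed.

Lemma homotopyP (M N : gmod k) (pM : seq A -> ghom M M) (pN : seq A -> ghom N N)
    (f g r : seq A -> ghom M N) :
  @cochain k A (gHom N N) (-1) pN -> @cochain k A (gHom M N) 1 r ->
  (forall s, total_diff T nu true pN pM r s = f s - g s) ->
  is_homotopy nu pM pN f g r.
Proof.
move=> hN hr h; have hN0 : @CCu k A (gHom N N) 0 pN by apply/CCu_cochain; rewrite sub0r.
have hr2 : @CCu k A (gHom M N) 2 r by apply/CCu_cochain.
split=> // s; rewrite -h (star_cup _ _ _ hN0) (star_cup _ _ _ hr2).
rewrite (@gerst_insert k A (gHom M N)) (@insert_ge1_part (gHom M N)).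
rewrite /int_sign /= expr0 sqrrN expr1n !scale1r /total_diff /= expr0 scale1r.
by rewrite [RHS]addrAC [insert _ _ _ _ + _]addrC [LHS]addrC.
Qed.

Lemma cochain_strict (M N : gmod k) (q : ghom M N) :
  @homog k (gHom M N) 0 q -> @cochain k A (gHom M N) 0 (strict q).
Proof.
move=> hq; split=> [[|z s1] s2 a x y|[|x s] i /=].
- by rewrite /= scaler0 addr0.
- by rewrite /= scaler0 addr0.
- by move=> ->.
by move=> _; apply: homog0.
Qed.

Lemma cup_strict (L M N : gmod k) b (q : ghom M N) (f : seq A -> ghom L M) s :
  cup T b (strict q) f s = gcomp q (f s).
Proof.
rewrite /cup split_sum_first // => x u v; exact: gcomp0l.
Qed.

Lemma cup_strictr (L M N : gmod k) b (q : ghom L M) (f : seq A -> ghom M N) s :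
  cup T b f (strict q) s = gcomp (f (map (twist T b) s)) q.
Proof.
rewrite /cup split_sum_last // => x u v; exact: gcomp0r.
Qed.

(** Composition with q carries a sign because q has degree one in the
    suspended Hom module. *)
Lemma mod_comp_strict (L M N : gmod k) (q : ghom M N) (f : seq A -> ghom L M) s :
  @homog k (gHom M N) 0 q -> mod_comp (strict q) f s = - gcomp q (f s).
Proof.
move=> hq; rewrite /mod_comp (@star_cup _ _ _ _ _ _ 1); last first.
  exact/(CCu_cochain 1)/cochain_strict.
by rewrite int_sign1 scaleN1r cup_strict.
Qed.

Lemma strict_mod_morP (M N : gmod k) (pM : seq A -> ghom M M)
    (pN : seq A -> ghom N N) (q : ghom M N) :
  @cochain k A (gHom N N) (-1) pN -> @cochain k A (gHom M M) (-1) pM ->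
  is_mod_mor nu pM pN (strict q) <->
  @homog k (gHom M N) 0 q /\ forall s, gcomp q (pM s) = gcomp (pN s) q.
Proof.
move=> hN hM.
have e0 s : total_diff T nu false pN pM (strict q) s = gcomp (pN s) q - gcomp q (pM s).
  rewrite /total_diff /= cup_strict cup_strictr map_id expr1 scaleN1r.
  by rewrite insert0_in ?addr0 // => -[].
split=> [/(mod_morP _ _ hN)[hq h]|[hq h]].
  split; first exact: (hq.2 [::] 0 erefl).
  by move=> s; apply/eqP; rewrite eq_sym -subr_eq0 -e0 h.
apply/(mod_morP _ _ hN); split; first exact: cochain_strict.
by move=> s; rewrite e0 h subrr.
Qed.

End Modules.

(** * Hom complexes and the strict lifting property *)

Section LinearFunctions.
Variables (k : comPzRingType) (V W : lmodType k) (f : V -> W).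
Hypothesis fl : linear f.

Lemma linear_add x y : f (x + y) = f x + f y.
Proof. by rewrite -[x]scale1r fl !scale1r. Qed.

Lemma linear_0 : f 0 = 0.
Proof. by apply: (addrI (f 0)); rewrite -linear_add !addr0. Qed.

Lemma linear_sub x y : f (x - y) = f x - f y.
Proof. by rewrite addrC -scaleN1r fl scaleN1r addrC. Qed.

End LinearFunctions.

Section HomComplex.
Variable k : comPzRingType.
Implicit Types M N P X Y : gmod k.

Lemma deg_homog M N n (f : ghom M N) : @homog k (gHom M N) n f -> deg_map n f.
Proof. by move=> /homog_homP hf; split=> //; apply: hom_linear. Qed.

Lemma sign_inv_deg M N n (g : M -> N) x :
  deg_map n g -> sign_inv (g x) = int_sign k n *: g (sign_inv x).
Proof.
move=> [gl gd]; apply: (linear_ext (f := fun x => sign_inv (g x))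
  (g := fun x => int_sign k n *: g (sign_inv x))) => [a y z|a y z|i y hy].
- by rewrite gl sign_inv_linear.
- by rewrite sign_inv_linear gl scalerDr !scalerA mulrC.
rewrite (sign_inv_homog (gd _ _ hy)) (sign_inv_homog hy).
have gZ c : g (c *: y) = c *: g y.
  have g0 : g 0 = 0 by have := gl (-1) 0 0; rewrite scaler0 addr0 scaleN1r addNr.
  by have := gl c y 0; rewrite g0 !addr0.
by rewrite gZ scalerA int_signD mulrC.
Qed.

(** The sign of a map is conjugation by the signs of its source and target. *)
Lemma sign_inv_homE M N (h : ghom M N) x :
  (@sign_inv k (gHom M N) h : ghom M N) x = sign_inv (h (sign_inv x)).
Proof.
apply: (@linear_ext k (gHom M N) N
  (fun h : ghom M N => (@sign_inv k (gHom M N) h : ghom M N) x)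
  (fun h : ghom M N => sign_inv (h (sign_inv x)))) => [a f g|a f g|n f hf].
- by rewrite (@sign_inv_linear k (gHom M N)).
- by rewrite homDE homZE sign_inv_linear.
rewrite (sign_inv_homog hf) (sign_inv_deg _ (deg_homog hf)) sign_invK.
exact: homZE.
Qed.

Lemma sign_inv_gcompl M N P n (g : ghom N P) (f : ghom M N) :
  @homog k (gHom N P) n g ->
  (@sign_inv k (gHom M P) (gcomp g f) : ghom M P)
  = int_sign k n *: gcomp g (@sign_inv k (gHom M N) f).
Proof.
move=> hg; apply: hom_ext => x; rewrite sign_inv_homE homZE /=.
by rewrite (sign_inv_deg _ (deg_homog hg)) sign_inv_homE.
Qed.

Lemma sign_inv_gcompr M N P n (g : ghom N P) (f : ghom M N) :
  @homog k (gHom M N) n f ->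
  (@sign_inv k (gHom M P) (gcomp g f) : ghom M P)
  = int_sign k n *: gcomp (@sign_inv k (gHom N P) g) f.
Proof.
move=> hf; apply: hom_ext => x; rewrite sign_inv_homE homZE /=.
rewrite (sign_inv_homE g) (sign_inv_deg _ (deg_homog hf)) linearZ sign_invZ.
by rewrite scalerA int_signK scale1r.
Qed.

Lemma delta_homog M N (dM : ghom M M) (dN : ghom N N) n (f : ghom M N) :
  is_diff dM -> is_diff dN -> @homog k (gHom M N) n f ->
  @homog k (gHom M N) (n - 1) (delta_Hom dM dN f).
Proof.
move=> [hM _] [hN _] hf; rewrite delta_Hom_sign; apply: homogD.
  exact: homog_gcomp.
apply: homogN; rewrite addrC; apply: homog_gcomp => //; exact: homog_sign_inv.
Qed.

Lemma delta_linear M N (dM : ghom M M) (dN : ghom N N) :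
  @linear_for k (gHom M N) (gHom M N) *:%R (delta_Hom dM dN).
Proof.
move=> a f g; rewrite !delta_Hom_sign (@sign_inv_linear k (gHom M N)).
rewrite gcompDr gcompZr gcompDl gcompZl scalerBr.
by zmod_equality.
Qed.

Lemma delta_deg M N (dM : ghom M M) (dN : ghom N N) :
  is_diff dM -> is_diff dN -> @deg_map k (gHom M N) (gHom M N) (-1) (delta_Hom dM dN).
Proof.
move=> hM hN; split; first exact: delta_linear.
by move=> i f; apply: delta_homog.
Qed.

Lemma delta_delta M N (dM : ghom M M) (dN : ghom N N) (f : ghom M N) :
  is_diff dM -> is_diff dN -> delta_Hom dM dN (delta_Hom dM dN f) = 0.
Proof.
move=> [hM dM2] [hN dN2].
have dd : gcomp dN dN = 0 by apply: hom_ext.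
have dd' : gcomp dM dM = 0 by apply: hom_ext.
rewrite [delta_Hom dM dN f]delta_Hom_sign delta_Hom_sign.
have sB (x y : gHom M N) : sign_inv (x - y) = sign_inv x - sign_inv y.
  by rewrite sign_invD -scaleN1r sign_invZ scaleN1r.
rewrite sB (sign_inv_gcompl _ hN) (sign_inv_gcompr _ hM).
rewrite (@sign_invK k (gHom M N)) int_signN int_sign1 !scaleN1r.
rewrite !(gcompDr, gcompDl, gcompNl, gcompNr, gcompA) dd -!gcompA dd'.
by rewrite gcomp0l gcomp0r; zmod_equality.
Qed.

Lemma delta_gcomp P X Y (dP : ghom P P) (dX : ghom X X) (dY : ghom Y Y)
    (f : ghom X Y) (h : ghom P X) :
  chain_map dX dY f -> gcomp f (delta_Hom dP dX h) = delta_Hom dP dY (gcomp f h).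
Proof.
move=> [hf fd]; rewrite !delta_Hom_sign gcompDr gcompNr !gcompA.
rewrite (sign_inv_gcompl _ hf) /int_sign expr0 scale1r; congr (_ - _).
by apply: hom_ext => x; apply: fd.
Qed.

(** The strict form of being a surjective quasi-isomorphism: lifting against
    the inclusion of a sphere into a disc. An element y can be lifted together
    with a prescribed boundary. It is the form in which obstructions are
    removed without disturbing what has been constructed before. *)
Definition fibration X Y (dX : X -> X) (dY : Y -> Y) (f : X -> Y) : Prop :=
  forall n y x', homog n y -> homog (n - 1) x' -> dX x' = 0 -> f x' = dY y ->
    exists x, [/\ homog n x, f x = y & dX x = x'].

(** The cycle x' bounds some z as its image bounds y. The difference f z - y is a
    cycle, hence homologous to the image of a cycle x, and the boundary between
    them lifts as f is onto; subtracting both corrections from z gives the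
    lift. *)
Lemma fibration_of_surj_quasi_iso X Y (dX : X -> X) (dY : Y -> Y) (f : X -> Y) :
  deg_map (-1) dX -> (forall x, dX (dX x) = 0) ->
  deg_map (-1) dY -> (forall y, dY (dY y) = 0) ->
  deg_map 0 f -> (forall x, f (dX x) = dY (f x)) ->
  surj_quasi_iso dX dY f -> fibration dX dY f.
Proof.
move=> [dXl dXd] dX2 [dYl dYd] dY2 [fl fd] fdX [fs fq] n y x' hy hx' dx' fx'.
have [inj _] := fq (n - 1); have [_ sur] := fq n.
have [|z hz ez] := inj x' hx' dx'; first by exists y; rewrite // subrK.
rewrite subrK in hz.
have hfz : homog n (f z - y).
  by apply: homogD; [rewrite -[n]addr0; apply: fd | apply: homogN].
have [|x [w [hx dx hw ew]]] := sur _ hfz.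
  by rewrite (linear_sub dYl) -fdX -ez fx' subrr.
have [w0 hw0] := fs w.
have fw : f (pr X (n + 1) w0) = w.
  have prf : pr Y (n + 1) (f w0) = f (pr X (n + 1) w0).
    apply: (linear_ext (f := fun v => pr Y (n + 1) (f v))
             (g := fun v => f (pr X (n + 1) v))) => [a u v|a u v|i v hv].
    - by rewrite fl linearP.
    - by rewrite linearP fl.
    have hfv : homog i (f v) by rewrite -[i]addr0; apply: fd.
    have [->|ne] := eqVneq (n + 1) i; first by rewrite hfv hv.
    by rewrite (pr_neq ne hfv) (pr_neq ne hv) (linear_0 fl).
  by rewrite -prf hw0.
exists (z - x - dX (pr X (n + 1) w0)); split.
- apply: homogD; first by apply: homogD => //; apply: homogN.
  by apply: homogN; have := dXd _ _ (pr_homog (n + 1) w0); rewrite addrK.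
- by rewrite !(linear_sub fl) fdX fw -addrA -opprD -ew opprB addrCA subrr addr0.
by rewrite !(linear_sub dXl) dX2 dx !subr0 -ez.
Qed.

(** To lift an arbitrary y, first lift its boundary to a cycle. *)
Lemma surj_quasi_iso_of_fibration X Y (dX : X -> X) (dY : Y -> Y) (f : X -> Y) :
  deg_map (-1) dX -> (forall x, dX (dX x) = 0) ->
  deg_map (-1) dY -> (forall y, dY (dY y) = 0) ->
  deg_map 0 f -> (forall x, f (dX x) = dY (f x)) ->
  fibration dX dY f -> surj_quasi_iso dX dY f.
Proof.
move=> [dXl dXd] dX2 [dYl dYd] dY2 [fl fd] fdX hf.
have surj n y : homog n y -> exists x, f x = y.
  move=> hy.
  have [||||x' [hx' fx' dx']] := hf (n - 1) (dY y) 0.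
  - exact: dYd.
  - exact: homog0.
  - exact: (linear_0 dXl).
  - by rewrite dY2 (linear_0 fl).
  by have [x [_ fx _]] := hf n y x' hy hx' dx' fx'; exists x.
split=> [y|n]; last split.
- rewrite (suppP y).2; elim: (supp y) => [|i s [x hx]].
    by exists 0; rewrite big_nil (linear_0 fl).
  have [z hz] := surj i _ (pr_homog i y).
  by exists (z + x); rewrite big_cons (linear_add fl) hz hx.
- move=> x hx dx [y hy fx].
  have [|||z [hz _ dz]] := hf (n + 1) y x hy; rewrite ?addrK //.
  by exists z.
move=> y hy dy.
have [|||x [hx fx dx]] := hf n y 0 hy.
- exact: homog0.
- exact: (linear_0 dXl).
- by rewrite dy (linear_0 fl).
exists x, 0; split=> //; first exact: homog0.
by rewrite (linear_0 dYl) addr0.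
Qed.

End HomComplex.

Section HomFibration.
Variables (k : comPzRingType) (P : gmod k) (dP : ghom P P).
Hypothesis semiproj : semiprojective dP.

Lemma hom_fibration (X Y : gmod k) (dX : ghom X X) (dY : ghom Y Y) (f : ghom X Y) :
  is_diff dX -> is_diff dY -> chain_map dX dY f -> surj_quasi_iso dX dY f ->
  @fibration k (gHom P X) (gHom P Y) (delta_Hom dP dX) (delta_Hom dP dY) (gcomp f).
Proof.
have [hP lift] := semiproj; move=> hX hY hf hq.
apply: fibration_of_surj_quasi_iso.
- exact: delta_deg.
- by move=> h; apply: delta_delta.
- exact: delta_deg.
- by move=> h; apply: delta_delta.
- split=> [a u v|i h hh]; first by rewrite gcompDr gcompZr.
  by apply: homog_gcomp hh; case: hf.
- by move=> h; apply: delta_gcomp.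
exact: lift.
Qed.

Variables (e : P) (sigma : P -> k) (m : int).
Hypothesis he : homog m e.
Hypothesis dPe : dP e = 0.
Hypothesis sigma_linear : linear (sigma : P -> k^o).
Hypothesis sigma_e : sigma e = 1.
Hypothesis sigma_homog : forall i x, i != m -> homog i x -> sigma x = 0.

Lemma rank_one_deg (X : gmod k) n (w : X) :
  homog (m + n) w -> deg_map n (fun x : P => sigma x *: w).
Proof.
move=> hw; split=> [a x y|i x hx].
  by rewrite sigma_linear scalerDl -scalerA.
have [->|ne] := eqVneq i m; first exact: homogZ.
by rewrite (sigma_homog ne hx) scale0r; apply: homog0.
Qed.

(** The quotient of P by e is again semiprojective, expressed without
    forming it. A lift chi given by P need not kill e, but chi e is a cycle over
    0, hence the boundary of some w over 0; subtracting the boundary of the map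
    sigma (-) w kills it and changes neither the image nor the boundary of
    chi. *)
Lemma reduced_hom_lift (X Y : gmod k) (dX : ghom X X) (dY : ghom Y Y)
    (f : ghom X Y) n (phi : ghom P Y) (psi : ghom P X) :
  is_diff dX -> is_diff dY -> chain_map dX dY f -> fibration dX dY f ->
  @homog k (gHom P Y) n phi -> @homog k (gHom P X) (n - 1) psi ->
  phi e = 0 -> psi e = 0 -> delta_Hom dP dX psi = 0 ->
  gcomp f psi = delta_Hom dP dY phi ->
  exists chi : ghom P X, [/\ @homog k (gHom P X) n chi, gcomp f chi = phi,
    delta_Hom dP dX chi = psi & chi e = 0].
Proof.
move=> hX hY hf fib hphi hpsi phie psie dpsi fpsi.
have hP := semiproj.1.
have fq : surj_quasi_iso dX dY f.
  apply: surj_quasi_iso_of_fibration fib.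
  - exact: deg_homog hX.1.
  - exact: hX.2.
  - exact: deg_homog hY.1.
  - exact: hY.2.
  - exact: deg_homog hf.1.
  - exact: hf.2.
have [chi [hchi fchi dchi]] := hom_fibration hX hY hf fq hphi hpsi dpsi fpsi.
have delta_e (Z : gmod k) (dZ : ghom Z Z) (h : ghom P Z) : delta_Hom dP dZ h e = dZ (h e).
  by rewrite delta_Hom_sign homDE homNE /= dPe raddf0 subr0.
have chie : homog (m + n) (chi e) by case: (deg_homog hchi) => _; apply.
have [||||w [hw fw dw]] := fib (m + n + 1) 0 (chi e).
- exact: homog0.
- by rewrite addrK.
- by rewrite -delta_e dchi.
- by rewrite raddf0 -[LHS]/(gcomp f chi e) fchi.
rewrite -addrA in hw; have wd := rank_one_deg hw.
pose ws : ghom P X := MkGhom (deg_map_hom wd).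
have hws : @homog k (gHom P X) (n + 1) ws by apply/homog_homP; exact: wd.2.
exists (chi - delta_Hom dP dX ws); split.
- apply: (@homogD k (gHom P X)) => //; apply: (@homogN k (gHom P X)).
  by have := delta_homog hP hX hws; rewrite addrK.
- rewrite gcompDr gcompNr fchi (delta_gcomp _ _ hf).
  rewrite (_ : gcomp f ws = 0); last by apply: hom_ext => x; rewrite /= linearZ /= fw scaler0.
  rewrite (linear_0 (V := gHom P Y) (W := gHom P Y) (delta_linear dP dY)).
  by rewrite subr0.
- rewrite (linear_sub (V := gHom P X) (W := gHom P X) (delta_linear dP dX)).
  by rewrite delta_delta // subr0.
by rewrite homDE homNE delta_e /= sigma_e scale1r dw subrr.
Qed.

End HomFibration.

(** * Maps vanishing on the unit *)

Section ReducedHom.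
Variables (k : comPzRingType) (P X : gmod k) (e : P).

(** Asking every component of e to be killed makes this a graded submodule of
    the Hom module without assuming that e is homogeneous. *)
Definition kills_pred : {pred ghom P X} := fun h => `[< forall i, h (pr P i e) = 0 >].

Lemma kills_pred_submod : submod_closed kills_pred.
Proof.
split=> [|a f g]; first by apply/asboolP.
move=> /asboolP hf /asboolP hg; apply/asboolP => i.
by rewrite homDE homZE hf hg scaler0 addr0.
Qed.

HB.instance Definition _ :=
  GRing.isSubmodClosed.Build k (ghom P X) kills_pred kills_pred_submod.

Record reduced_hom := ReducedHom { red_val :> ghom P X; _ : red_val \in kills_pred }.

HB.instance Definition _ := [isSub for red_val].
HB.instance Definition _ := [Choice of reduced_hom by <:].
HB.instance Definition _ := [SubChoice_isSubLmodule of reduced_hom by <:].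

Lemma red_ext (f g : reduced_hom) : (forall x, f x = g x) -> f = g.
Proof. by move=> fg; apply/val_inj/hom_ext. Qed.

Lemma red_linear a (f g : reduced_hom) :
  red_val (a *: f + g) = a *: red_val f + red_val g.
Proof. by []. Qed.

Lemma kills_hpr n (h : reduced_hom) : hpr n h \in kills_pred.
Proof.
case: h => h /= /asboolP hk; apply/asboolP => i.
by rewrite (hprE n h (pr_homog i e)) hk raddf0.
Qed.

Definition red_pr n (h : reduced_hom) : reduced_hom := ReducedHom (kills_hpr n h).

Lemma red_pr_linear n : linear (red_pr n).
Proof. by move=> a f g; apply: val_inj; rewrite /= linearP. Qed.

HB.instance Definition _ n :=
  GRing.isLinear.Build k reduced_hom reduced_hom *:%R (red_pr n) (@red_pr_linear n).

Lemma red_prK i j (h : reduced_hom) :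
  red_pr i (red_pr j h) = if i == j then red_pr j h else 0.
Proof. by apply: val_inj; rewrite /= hprK; case: eqP. Qed.

Lemma red_pr_sum (h : reduced_hom) :
  exists2 s : seq int, uniq s & h = \sum_(i <- s) red_pr i h.
Proof.
have [s us hs] := hpr_sum h; exists s => //; apply: val_inj; rewrite [LHS]hs.
by elim: s {us hs} => [|i s IH]; rewrite ?big_nil // !big_cons /= IH.
Qed.

Definition gRed : gmod k := @Gmod k reduced_hom red_pr red_prK red_pr_sum.

Lemma homog_red n (h : reduced_hom) :
  @homog k gRed n h <-> @homog k (gHom P X) n (red_val h).
Proof. by split=> [/(congr1 red_val)|h']; last apply: val_inj. Qed.

Lemma killsP m (h : ghom P X) : homog m e -> h e = 0 -> h \in kills_pred.
Proof.
move=> he h0; apply/asboolP => i; have [->|ne] := eqVneq i m; first by rewrite he.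
by rewrite (pr_neq ne he) raddf0.
Qed.

Lemma red_e m (h : reduced_hom) : homog m e -> h e = 0.
Proof. by move=> he; case: h => h /= /asboolP /(_ m); rewrite he. Qed.

End ReducedHom.

(** * Currying the last argument of a reduced cochain *)

Section SplitUnit.
Variables (k : comPzRingType) (A : gmod k) (e : A) (sigma : {scalar A}).
Variable nu : seq A -> A.
Hypothesis hA : ainf_split_unit e sigma nu.
Local Notation T := (@bar_sign k A).

Lemma ainf_cochain : @cochain k A (shift A) (-1) nu.
Proof. by case: hA => _ [[h _] _] _; apply/CCu_shift. Qed.

Lemma ainf_square s : insert T nu nu s = 0.
Proof. by case: hA => _ [_ h] _; rewrite -gerst_insert. Qed.

Lemma unit_homog : @homog k (shift A) 1 e.
Proof. by case: hA => -[he _ _ _] _ _; apply/homog_shift. Qed.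

Lemma unit_bar_sign : T e = - e.
Proof. by rewrite (bar_sign_homog unit_homog) int_sign1 scaleN1r. Qed.

Lemma ainf_unitl x : nu [:: e; x] = x.
Proof.
have [_ _ [h _]] := hA; have [nul _] := ainf_cochain.
apply: (@linear_ext k A A (fun x => nu [:: e; x]) id) => // [a y z|i y hy].
  exact: (nul [:: e] [::]).
by case: (h i y hy).
Qed.

Lemma ainf_unitr x : nu [:: x; e] = - T x.
Proof.
have [_ _ [h _]] := hA; have [nul _] := ainf_cochain.
apply: (@linear_ext k A A (fun x => nu [:: x; e]) (fun x => - T x)) => [a y z|a y z|i y hy].
- exact: (nul [::] [:: e]).
- by rewrite bar_sign_linear opprD scalerN.
have [_ hy2] := h i y hy.
have hy1 : @homog k (shift A) (i + 1) y by apply/homog_shift; rewrite addrK.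
rewrite (bar_sign_homog hy1) int_signD int_sign1 mulrN1 scaleNr opprK.
exact: int_sign_swap.
Qed.

Lemma ainf_unit u w : size (u ++ e :: w) != 2 -> nu (u ++ e :: w) = 0.
Proof. by case: hA => _ _ [_ h]; apply: h. Qed.

Lemma ainf_unit1 : nu [:: e] = 0.
Proof. exact: (ainf_unit (u := [::])). Qed.

Lemma ainf_nu1E x : nu1 nu x = nu [:: x].
Proof. by apply: nu1E; case: hA. Qed.

Lemma sigma_linear : linear (sigma : A -> k^o).
Proof. by move=> a x y; rewrite linearP. Qed.

Lemma sigma_unit : sigma e = 1.
Proof. by case: hA => -[]. Qed.

Lemma sigma_homog i x : i != 1 -> @homog k (shift A) i x -> sigma x = 0.
Proof.
move=> i1 /homog_shift hx; case: hA => -[_ _ _ h] _ _; apply: h hx.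
by rewrite subr_eq0.
Qed.

Local Notation nu_1 := (@tensor_part k A A 1 nu).

Lemma insert_nu_1_cons (V : zmodType) (f : seq A -> V) x s :
  slot_additive f ->
  insert T nu_1 f (x :: s)
  = f (nu [:: x] :: s) + insert T nu_1 (fun t => f (T x :: t)) s.
Proof.
move=> fD /=; congr (_ + _); rewrite split_sum_first // => y u v.
exact: (slot_additive0 [::]).
Qed.

(** The insertion of the unary operation is the differential of a tensor
    power; it splits off the last tensor factor. *)
Lemma insert_nu_1_rcons (V : zmodType) (f : seq A -> V) a s :
  slot_additive f ->
  insert T nu_1 f (rcons s a)
  = insert T nu_1 (fun t => f (rcons t a)) s + f (rcons (map T s) (nu [:: a])).
Proof.
elim: s f => [|x s IH] f fD; first by rewrite [rcons _ _]/= insert_nu_1_cons // addrC.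
have fxD : slot_additive (fun t => f (T x :: t)) by move=> u; apply: (fD (_ :: u)).
rewrite rcons_cons !insert_nu_1_cons //.
  by rewrite IH // addrA.
by move=> u y z w; rewrite !rcons_cat; apply: fD.
Qed.

(** The differential of the complex of cochains of a fixed tensor degree. *)
Definition tensor_diff (W : gmod k) (n : int) (d : W -> W) (f : seq A -> W) s : W :=
  d (f s) - int_sign k n *: insert T nu_1 f s.

Local Notation RH W := (@reduced_hom k (shift A) W e).
Local Notation gRH W := (@gRed k (shift A) W e).

Section Currying.
Variable W : gmod k.

(** Splitting off the last argument rather than the first is what makes the
    signs of the tensor and Hom differentials match, as shown by
    tensor_diff_uncurry below. *)
Definition curry_last (f : seq A -> W) (s : seq A) : RH W :=
  insubd 0 (@to_hom k (shift A) W (fun a => f (rcons s a))).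

(** The value on the empty sequence is a default: only sequences of positive
    length come from a curried cochain. *)
Definition uncurry_last (f : seq A -> gRH W) (s : seq A) : W :=
  if s is x :: s' then (f (belast x s') : RH W) (last x s') else 0.

Lemma uncurry_rcons f s a : uncurry_last f (rcons s a) = (f s : RH W) a.
Proof. by case: s => [|x s] //=; rewrite belast_rcons last_rcons. Qed.

(** For homogeneous s the function has a single degree; in general s is
    expanded into sequences with homogeneous entries, and finitely many degrees
    occur. *)
Lemma cochain_rcons_hom n (f : seq A -> W) s :
  cochain n f -> (fun a => f (rcons s a)) \in @hom_pred k (shift A) W.
Proof.
move=> [fl fd].
have H t i : @homog_seq k (shift A) t i ->
    (fun a => f (t ++ rcons s a)) \in @hom_pred k (shift A) W.
  elim: s t i => [|x s IH] t i ht /=.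
    apply: (@deg_map_hom _ _ _ (i + n)); split=> [a y z|j y hy].
      exact: (fl t [::]).
    rewrite addrA (addrC j); apply: fd; apply: homog_seq_cat => //=.
    by exists j; rewrite ?subrr.
  rewrite (_ : (fun a => _) = fun a => \sum_(j <- @supp k (shift A) x)
     f (rcons t (pr (shift A) j x) ++ rcons s a)); last first.
    apply/funext => a; rewrite {1}(@suppP k (shift A) x).2.
    elim: (@supp k (shift A) x) => [|j r IHr].
      rewrite !big_nil; have := multilinear_scale t 0 0 (rcons s a) fl.
      by rewrite !scale0r.
    rewrite !big_cons; have := fl t (rcons s a) 1 (pr (shift A) j x).
    by rewrite !scale1r => ->; rewrite cat_rcons; congr (_ + _).
  elim: (@supp k (shift A) x) => [|j r IHr].
    rewrite (_ : (fun a => _) = hom_fun (0 : ghom (shift A) W)); first exact: valP.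
    by apply/funext => a; rewrite big_nil.
  have hj : (fun a => f (rcons t (pr (shift A) j x) ++ rcons s a))
      \in @hom_pred k (shift A) W.
    apply: (IH _ (i + j)); rewrite -cats1; apply: homog_seq_cat => //=.
    by exists j; [apply: pr_homog | rewrite subrr].
  rewrite (_ : (fun a => _) = hom_fun (MkGhom hj + MkGhom IHr)); first exact: valP.
  by apply/funext => a; rewrite big_cons.
exact: (H [::] 0).
Qed.

Lemma curryE n (f : seq A -> W) s a :
  cochain n f -> @vanish_on k A W e f -> curry_last f s a = f (rcons s a).
Proof.
move=> hf fe; have hh := cochain_rcons_hom s hf.
have th : @to_hom k (shift A) W (fun a => f (rcons s a)) = MkGhom hh.
  by apply: val_inj; rewrite /to_hom insubdK.
rewrite /curry_last insubdK ?th //.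
by apply: (killsP unit_homog); rewrite /= -cats1.
Qed.

Lemma cochain_curry n (f : seq A -> W) :
  cochain n f -> @vanish_on k A W e f ->
  @cochain k A (gRH W) n (curry_last f) /\ @vanish_on k A (gRH W) e (curry_last f).
Proof.
move=> hf fe; have cE := fun s a => curryE s a hf fe.
split=> [|s1 s2]; last first.
  by apply: red_ext => a; rewrite cE rcons_cat rcons_cons.
split=> [s1 s2 a x y|s i hs].
  apply: red_ext => b; rewrite red_linear homDE homZE !cE !rcons_cat !rcons_cons.
  by case: hf => ->.
apply/homog_red/homog_homP => j x hx; rewrite cE.
have -> : j + (i + n) = i + j + n by zmod_equality.
apply: hf.2; rewrite -cats1; apply: homog_seq_cat => //=.
by exists j; rewrite ?subrr.
Qed.

Lemma homog_seq_rcons s a i :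
  @homog_seq k (shift A) (rcons s a) i ->
  exists2 j, @homog k (shift A) j a & @homog_seq k (shift A) s (i - j).
Proof.
elim: s i => [|x s IH] i /=.
  by case=> j ha; exists j.
case=> j hx /IH [l ha hs]; exists l => //; exists j => //.
by rewrite addrAC.
Qed.

Lemma cochain_uncurry n f :
  @cochain k A (gRH W) n f -> @vanish_on k A (gRH W) e f ->
  cochain n (uncurry_last f) /\ @vanish_on k A W e (uncurry_last f).
Proof.
move=> [fl fd] fe; split; first split.
- move=> s1 s2 a x y; case/lastP: s2 => [|s2 b].
    by rewrite !cats1 !uncurry_rcons linearP.
  by rewrite -!rcons_cons -!rcons_cat !uncurry_rcons fl red_linear.
- move=> s i; case/lastP: s => [|s a]; first by move=> _; apply: homog0.
  move=> /homog_seq_rcons [j ha hs]; rewrite uncurry_rcons.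
  have /homog_red/homog_homP h := fd _ _ hs.
  by have := h _ _ ha; rewrite (_ : j + (i - j + n) = i + n) //; zmod_equality.
move=> s1 s2; case/lastP: s2 => [|s2 b].
  by rewrite cats1 uncurry_rcons (red_e _ unit_homog).
by rewrite -rcons_cons -rcons_cat uncurry_rcons fe.
Qed.

(** The adjunction between tensor products and Hom, as complexes. *)
Lemma tensor_diff_uncurry n (dW : ghom W W) f s a :
  @cochain k A (gRH W) n f -> @vanish_on k A (gRH W) e f ->
  tensor_diff n dW (uncurry_last f) (rcons s a)
  = delta_Hom (nu1 nu) dW (f s : RH W) a
    - int_sign k n *: (insert T nu_1 f s : RH W) a.
Proof.
move=> hf fe; have [hu ue] := cochain_uncurry hf fe.
rewrite /tensor_diff insert_nu_1_rcons; last exact: cochain_additive hu.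
rewrite uncurry_rcons delta_Hom_sign homDE homNE /= scalerDr opprD addrA addrAC.
rewrite ainf_nu1E; congr (_ - _ - _ *: _).
  rewrite sign_inv_homE -uncurry_rcons.
  have := cochain_sign (rcons s (@sign_inv k (shift A) (nu [:: a]))) hu.
  rewrite map_rcons [bar_sign _](_ : _ = nu [:: a]); last exact: bar_signK.
  by move/int_sign_swap.
rewrite (@insert_additive _ _ _ _ _ (fun h : RH W => h a)) //.
by apply: eq_insert => t; rewrite uncurry_rcons.
Qed.

End Currying.
End SplitUnit.

(** * Lifting cochains of a fixed tensor degree *)

Section CochainLift.
Variables (k : comPzRingType) (A : gmod k) (e : A) (sigma : {scalar A}).
Variable nu : seq A -> A.
Hypothesis hA : ainf_split_unit e sigma nu.
Hypothesis hsp : semiprojective (nu1 nu).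
Local Notation T := (@bar_sign k A).
Local Notation nu_1 := (@tensor_part k A A 1 nu).
Local Notation RH W := (@reduced_hom k (shift A) W e).
Local Notation gRH W := (@gRed k (shift A) W e).

(** The value 0 is a default: by red_diffE the differential of a map killing e
    kills e. *)
Definition red_diff (W : gmod k) (dW : ghom W W) : ghom (gRH W) (gRH W) :=
  @to_hom k (gRH W) (gRH W)
    (fun h : RH W => insubd (0 : RH W) (delta_Hom (nu1 nu) dW h)).

Definition red_map (X Y : gmod k) (f : ghom X Y) : ghom (gRH X) (gRH Y) :=
  @to_hom k (gRH X) (gRH Y) (fun h : RH X => insubd (0 : RH Y) (gcomp f h)).

Lemma red_diffE (W : gmod k) (dW : ghom W W) (h : RH W) :
  is_diff dW -> red_val (red_diff dW h) = delta_Hom (nu1 nu) dW h.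
Proof.
move=> hW.
have E (g : RH W) : red_val (insubd (0 : RH W) (delta_Hom (nu1 nu) dW g))
    = delta_Hom (nu1 nu) dW g.
  apply: insubdK; apply: (killsP (unit_homog hA)).
  rewrite delta_Hom_sign homDE homNE /= (ainf_nu1E hA) (ainf_unit1 hA) raddf0 subr0.
  by rewrite (red_e _ (unit_homog hA)) raddf0.
rewrite /red_diff (@to_homE _ _ _ (-1)) //; split=> [a f g|i f hf].
  apply: val_inj; rewrite [LHS]E [RHS]red_linear !E.
  exact: (@delta_linear k (shift A) W (nu1 nu) dW a f g).
apply/homog_red; rewrite E; apply: delta_homog => //; first exact: hsp.1.
exact/homog_red.
Qed.

Lemma red_mapE (X Y : gmod k) (f : ghom X Y) (h : RH X) :
  @homog k (gHom X Y) 0 f -> red_val (red_map f h) = gcomp f h.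
Proof.
move=> hf.
have E (g : RH X) : red_val (insubd (0 : RH Y) (gcomp f g)) = gcomp f g.
  apply: insubdK; apply: (killsP (unit_homog hA)).
  by rewrite /= (red_e _ (unit_homog hA)) raddf0.
rewrite /red_map (@to_homE _ _ _ 0) //; split=> [a g g'|i g hg].
  by apply: val_inj; rewrite [LHS]E [RHS]red_linear !E red_linear gcompDr gcompZr.
apply/homog_red; rewrite E; apply: (@homog_gcomp k (shift A) X Y 0 i) => //.
exact/homog_red.
Qed.

Lemma red_is_diff (W : gmod k) (dW : ghom W W) : is_diff dW -> is_diff (red_diff dW).
Proof.
move=> hW; split=> [|h].
  apply/homog_homP => i h hh; apply/homog_red; rewrite red_diffE //.
  by apply: delta_homog => //; [exact: hsp.1 | exact/homog_red].
by apply: val_inj; rewrite /= !red_diffE // delta_delta //; exact: hsp.1.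
Qed.

Lemma red_chain_map (X Y : gmod k) (dX : ghom X X) (dY : ghom Y Y) (f : ghom X Y) :
  is_diff dX -> is_diff dY -> chain_map dX dY f ->
  chain_map (red_diff dX) (red_diff dY) (red_map f).
Proof.
move=> hX hY hf; split=> [|h].
  apply/homog_homP => i h hh; apply/homog_red; rewrite red_mapE; last exact: hf.1.
  by apply: (@homog_gcomp k (shift A) X Y 0 i) => //; [exact: hf.1 | apply/homog_red].
apply: val_inj; rewrite /= red_diffE // !red_mapE; try exact: hf.1.
by rewrite red_diffE // (delta_gcomp _ _ hf).
Qed.

Lemma red_fibration (X Y : gmod k) (dX : ghom X X) (dY : ghom Y Y) (f : ghom X Y) :
  is_diff dX -> is_diff dY -> chain_map dX dY f -> fibration dX dY f ->
  fibration (red_diff dX) (red_diff dY) (red_map f).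
Proof.
move=> hX hY hf fib n phi psi hphi hpsi dpsi fpsi.
have he := unit_homog hA.
have [||||||||||chi [hchi fchi dchi chie]] :=
  @reduced_hom_lift k (shift A) (nu1 nu) hsp e sigma 1 he _ _ _ _
    X Y dX dY f n (red_val phi) (red_val psi) hX hY hf fib.
- by rewrite (ainf_nu1E hA) (ainf_unit1 hA).
- exact: sigma_linear.
- exact: sigma_unit hA.
- by move=> i x; apply: sigma_homog hA _ _.
- exact/homog_red.
- exact/homog_red.
- exact: red_e he.
- exact: red_e he.
- by have := congr1 (fun h : RH X => red_val h) dpsi; rewrite red_diffE.
- have := congr1 (fun h : RH Y => red_val h) fpsi.
  by rewrite red_diffE // red_mapE //; exact: hf.1.
exists (ReducedHom (killsP he chie)); split.
- exact/homog_red.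
- by apply: val_inj; rewrite /= red_mapE //; exact: hf.1.
by apply: val_inj; rewrite /= red_diffE.
Qed.

Lemma tensor_diff_curry (W : gmod k) n (dW : ghom W W) (f : seq A -> W) s a :
  is_diff dW -> cochain n f -> @vanish_on k A W e f ->
  tensor_diff nu n dW f (rcons s a)
  = (tensor_diff nu n (red_diff dW) (curry_last e f : seq A -> gRH W) s : RH W) a.
Proof.
move=> hW hf fe; have [hc ce] := cochain_curry hA hf fe.
have E t b : uncurry_last (curry_last e f) (rcons t b) = f (rcons t b).
  by rewrite uncurry_rcons (curryE hA _ _ hf fe).
have := tensor_diff_uncurry hA dW s a hc ce.
rewrite /tensor_diff E.
have -> : insert T nu_1 (uncurry_last (curry_last e f)) (rcons s a) = insert T nu_1 f (rcons s a).
  apply: eq_insert_in => u v w _ _.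
  by case/lastP: w => [|w b]; rewrite ?cats1 -?rcons_cons -?rcons_cat E.
move=> ->; rewrite -red_diffE //.
Qed.

(** By adjunction a reduced cochain of tensor degree l + 1 with values in X is
    one of tensor degree l with values in the reduced Hom complex to X, and this
    complex inherits the lifting property. In tensor degree 0 the lifting
    property is that of X. *)
Lemma cochain_lift l (X Y : gmod k) (dX : ghom X X) (dY : ghom Y Y)
    (f : ghom X Y) n (phi : seq A -> Y) (psi : seq A -> X) :
  is_diff dX -> is_diff dY -> chain_map dX dY f -> fibration dX dY f ->
  cochain n phi -> @vanish_on k A Y e phi ->
  cochain (n - 1) psi -> @vanish_on k A X e psi ->
  (forall s, size s = l -> tensor_diff nu (n - 1) dX psi s = 0) ->
  (forall s, size s = l -> f (psi s) = tensor_diff nu n dY phi s) ->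
  exists chi : seq A -> X,
    [/\ cochain n chi, @vanish_on k A X e chi,
        forall s, size s <> l -> chi s = 0,
        forall s, size s = l -> f (chi s) = phi s &
        forall s, size s = l -> tensor_diff nu n dX chi s = psi s].
Proof.
elim: l X Y dX dY f phi psi => [|l IH] X Y dX dY f phi psi hX hY hf fib hphi phie
    hpsi psie dpsi fpsi.
  have [||||x [hx fx dx]] := fib n (phi [::]) (psi [::]).
  - by rewrite -[n]add0r; apply: hphi.2.
  - by rewrite -[n - 1]add0r; apply: hpsi.2.
  - by have := dpsi [::] erefl; rewrite /tensor_diff /= scaler0 subr0.
  - by have := fpsi [::] erefl; rewrite /tensor_diff /= scaler0 subr0.
  exists (fun s => if s is [::] then x else 0); split.
  - split=> [[|z s1] s2 a y y'|[|y s] i] /=; rewrite ?scaler0 ?addr0 //.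
      by move=> ->; rewrite add0r.
    by move=> _; apply: homog0.
  - by case.
  - by case.
  - by case.
  by case=> // _; rewrite /tensor_diff /= scaler0 subr0.
have [hphic phice] := cochain_curry hA hphi phie.
have [hpsic psice] := cochain_curry hA hpsi psie.
have [||chi [hchi chie chi0 fchi dchi]] := IH _ _ _ _ _ _ _ (red_is_diff hX)
  (red_is_diff hY) (red_chain_map hX hY hf) (red_fibration hX hY hf fib)
  hphic phice hpsic psice.
- move=> s hs; apply: red_ext => a.
  by rewrite -tensor_diff_curry // dpsi // size_rcons hs.
- move=> s hs; apply: red_ext => a.
  rewrite -tensor_diff_curry // -fpsi ?size_rcons ?hs // red_mapE; last exact: hf.1.
  by rewrite /= (curryE hA _ _ hpsi psie).
have [hu ue] := cochain_uncurry hA hchi chie.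
exists (uncurry_last chi); split=> //; case/lastP=> [|s a] //; rewrite size_rcons.
- by move=> hs; rewrite uncurry_rcons chi0 // => hs'; apply: hs; rewrite hs'.
- move=> [hs]; rewrite uncurry_rcons.
  have /(congr1 (fun h : RH Y => h a)) := fchi s hs.
  by rewrite red_mapE; [rewrite (curryE hA _ _ hphi phie) | exact: hf.1].
move=> [hs]; rewrite (tensor_diff_uncurry hA _ _ _ hchi chie).
have /(congr1 (fun h : RH X => h a)) := dchi s hs.
rewrite (curryE hA _ _ hpsi psie) => <-.
by rewrite -red_diffE.
Qed.

End CochainLift.

(** * Lifting one tensor degree at a time *)

(** Dependent choice, followed by gluing: the components of the successive
    approximations stabilize, so they define a limit. *)
Lemma build_by_degree (A V : Type) (P : nat -> (seq A -> V) -> Prop) f0 :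
  P 0%N f0 ->
  (forall n f, P n f ->
     exists g, P n.+1 g /\ forall s, (size s < n)%N -> g s = f s) ->
  exists f, forall n, exists g, P n g /\ forall s, (size s < n)%N -> f s = g s.
Proof.
move=> P0 step.
pose next n (f : {f | P n f}) := cid (step n (sval f) (svalP f)).
pose F := fix F n : {f | P n f} :=
  if n is m.+1 then exist _ (sval (next m (F m))) (svalP (next m (F m))).1
  else exist _ f0 P0.
have agree n m s : (size s < n)%N -> sval (F (n + m)%N) s = sval (F n) s.
  move=> hs; elim: m => [|m IHm]; first by rewrite addn0.
  rewrite addnS -IHm; apply: (svalP (next _ (F (n + m)%N))).2.
  exact: leq_trans hs (leq_addr _ _).
exists (fun s => sval (F (size s).+1) s) => n; exists (sval (F n)).
split=> [|s hs]; first exact: svalP.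
by rewrite -(subnKC hs) [RHS]agree.
Qed.

Section LeadingTerm.
Variables (k : comPzRingType) (A : gmod k) (nu : seq A -> A).
Local Notation T := (@bar_sign k A).
Local Notation nu_1 := (@tensor_part k A A 1 nu).
Variables (M N : gmod k) (pM : seq A -> ghom M M) (pN : seq A -> ghom N N).

Lemma total_diff_below b m (f : seq A -> ghom M N) s :
  (forall t, (size t < m)%N -> f t = 0) -> (size s < m)%N ->
  total_diff T nu b pN pM f s = 0.
Proof.
move=> f0 sm; rewrite /total_diff /cup split_sum0 => [|u v uv]; last first.
  by rewrite f0 ?gcomp0r //; apply: leq_ltn_trans sm; rewrite -uv size_cat leq_addl.
rewrite split_sum0 => [|u v uv]; last first.
  rewrite f0 ?gcomp0l // size_map; apply: leq_ltn_trans sm.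
  by rewrite -uv size_cat leq_addr.
rewrite (@eq_insert_size _ _ _ _ f (fun _ => 0)) => [|t ts]; last first.
  by rewrite f0 //; apply: leq_ltn_trans sm.
by rewrite insert0 addr0 scaler0 addr0.
Qed.

Definition hom_diff (dM : ghom M M) (dN : ghom N N) : ghom (gHom M N) (gHom M N) :=
  @to_hom k (gHom M N) (gHom M N) (delta_Hom dM dN).

Lemma hom_diffE (dM : ghom M M) (dN : ghom N N) (f : ghom M N) :
  is_diff dM -> is_diff dN -> hom_diff dM dN f = delta_Hom dM dN f.
Proof.
move=> hM hN; rewrite /hom_diff (@to_homE _ _ _ (-1)) //.
exact: delta_deg.
Qed.

Lemma int_sign_odd n : int_sign k n = (-1) ^+ odd `|n|%N.
Proof. by rewrite signr_odd. Qed.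

(** On the lowest tensor degree in which f is nonzero, only the differentials
    of M and N and the unary operation of the algebra contribute. *)
Lemma total_diff_leading n m (f : seq A -> ghom M N) s :
  is_diff (pM [::]) -> is_diff (pN [::]) ->
  @cochain k A (gHom M N) n f ->
  (forall t, (size t < m)%N -> f t = 0) -> size s = m ->
  total_diff T nu (odd `|n|%N) pN pM f s
  = @tensor_diff k A nu (gHom M N) n (hom_diff (pM [::]) (pN [::])) f s.
Proof.
move=> hM hN hf f0 sm; have fD := cochain_additive hf.
rewrite /total_diff /tensor_diff hom_diffE // delta_Hom_sign.
have -> : cup T (odd `|n|%N) pN f s = gcomp (pN [::]) (f s).
  rewrite /cup; case: s sm => [|x s] //= sm; rewrite split_sum0 ?addr0 // => u v uv.
  by rewrite f0 ?gcomp0r // -sm -uv size_cat ltnS leq_addl.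
have -> : cup T true f pM s = gcomp (f (map T s)) (pM [::]).
  rewrite /cup -(cats0 s) in sm *; move: sm; rewrite cats0.
  case/lastP: s => [|s x] //; rewrite size_rcons => sm.
  rewrite -cats1 split_sum_cat /= split_sum0 ?add0r // => u v uv.
  rewrite f0 ?gcomp0l // size_map -sm ltnS -uv size_cat leq_addr //.
rewrite (cochain_sign s hf) int_sign_odd signrN.
have -> : insert T nu f s = insert T nu_1 f s.
  apply: eq_insert_in => u [|x [|y v]] w // _ uvw.
  rewrite [tensor_part _ _ _](_ : _ = 0) // slot_additive0 // f0 //.
  by rewrite -sm -uvw !size_cat /= size_map ltn_add2l !addSn !ltnS leq_addl.
rewrite gcompZl scalerDr !scaleNr scalerA -expr2 -exprM mulnC exprM sqrrN expr1n.
by rewrite expr1n scale1r addrA.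
Qed.

End LeadingTerm.

Section HomPostcomposition.
Variables (k : comPzRingType) (N G M : gmod k).
Variables (dN : ghom N N) (dG : ghom G G) (dM : ghom M M) (q : ghom G M).
Hypotheses (hN : is_diff dN) (hG : is_diff dG) (hM : is_diff dM).
Hypothesis hq : chain_map dG dM q.

Definition hom_post : ghom (gHom N G) (gHom N M) :=
  @to_hom k (gHom N G) (gHom N M) (gcomp q).

Lemma hom_postE (f : ghom N G) : hom_post f = gcomp q f.
Proof.
rewrite /hom_post (@to_homE _ _ _ 0) //; split=> [a u v|i f' hf'].
  by rewrite gcompDr gcompZr.
by apply: (@homog_gcomp k N G M 0 i) => //; exact: hq.1.
Qed.

Lemma hom_is_diff : is_diff (hom_diff dN dG).
Proof.
split=> [|f]; last by rewrite !hom_diffE // delta_delta.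
by apply/homog_homP => i f hf; rewrite hom_diffE //; apply: delta_homog.
Qed.

Lemma hom_post_chain_map : chain_map (hom_diff dN dG) (hom_diff dN dM) hom_post.
Proof.
split=> [|f]; last by rewrite !hom_postE !hom_diffE // (delta_gcomp _ _ hq).
apply/homog_homP => i f hf; rewrite hom_postE.
by apply: (@homog_gcomp k N G M 0 i) => //; exact: hq.1.
Qed.

Lemma hom_post_fibration :
  semiprojective dN -> surj_quasi_iso dG dM q ->
  fibration (hom_diff dN dG) (hom_diff dN dM) hom_post.
Proof.
move=> sp sq; have := hom_fibration sp hG hM hq sq.
congr (fibration _ _ _); apply/esym/funext => f.
- exact: hom_diffE.
- exact: hom_diffE.
exact: hom_postE.
Qed.

End HomPostcomposition.

Section Lifting.
Variables (k : comPzRingType) (A : gmod k) (e : A) (sigma : {scalar A}).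
Variable nu : seq A -> A.
Hypothesis hA : ainf_split_unit e sigma nu.
Hypothesis hsp : semiprojective (nu1 nu).
Local Notation T := (@bar_sign k A).

Lemma cochain_local (W : gmod k) n (f : seq A -> W) :
  (forall m, exists g, cochain n g /\ forall s, (size s < m)%N -> f s = g s) ->
  cochain n f.
Proof.
move=> h; split=> [s1 s2 a x y|s i hs].
  have [g [[gl _] fg]] := h (size (s1 ++ x :: s2)).+1.
  by rewrite !fg ?gl // !size_cat.
have [g [[_ gd] fg]] := h (size s).+1.
by rewrite fg //; apply: gd.
Qed.

Section Linear.
Variables (N G M : gmod k) (q : ghom G M).
Variables (pN : seq A -> ghom N N) (pG : seq A -> ghom G G).
Variable pM : seq A -> ghom M M.
Hypotheses (hN : is_su_module e nu pN) (hG : is_su_module e nu pG).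
Hypothesis hM : is_su_module e nu pM.
Hypothesis hq : chain_map (pG [::]) (pM [::]) q.
Hypothesis hqs : surj_quasi_iso (pG [::]) (pM [::]) q.
Hypothesis q_strict : forall s, gcomp q (pG s) = gcomp (pM s) q.
Hypothesis spN : semiprojective (pN [::]).

(** The lifting property of the map induced by q for the twisted differential:
    a cycle phi and a cochain alpha with compatible images have a common
    solution f. If f solves both equations in tensor degrees below m, then the
    errors phi - D f and alpha - q f start in tensor degree m. The first is
    D-closed because D squares to zero, so its leading term is a cycle for the
    untwisted differential, and cochain_lift corrects both errors in tensor
    degree m. *)
Lemma total_lift n b (phi : seq A -> ghom N G) (alpha : seq A -> ghom N M) :
  odd `|n|%N = b ->
  @cochain k A (gHom N G) (n - 1) phi -> @vanish_on k A (gHom N G) e phi ->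
  @cochain k A (gHom N M) n alpha -> @vanish_on k A (gHom N M) e alpha ->
  (forall s, total_diff T nu (~~ b) pG pN phi s = 0) ->
  (forall s, gcomp q (phi s) = total_diff T nu b pM pN alpha s) ->
  exists f : seq A -> ghom N G,
    [/\ @cochain k A (gHom N G) n f, @vanish_on k A (gHom N G) e f,
        forall s, gcomp q (f s) = alpha s &
        forall s, total_diff T nu b pG pN f s = phi s].
Proof.
move=> nb hphi phie halpha alphae dphi qphi.
have [cN uN1 N1 mN] := (su_moduleP e nu pN).1 hN.
have [cG uG1 G1 mG] := (su_moduleP e nu pG).1 hG.
have [cM uM1 M1 mM] := (su_moduleP e nu pM).1 hM.
have dN := spN.1; have [[_ dG _] _] := hG; have [[_ dM _] _] := hM.
have cnu := ainf_cochain hA.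
have nuT := cochain_nuT cnu.
have nuD := cochain_additive cnu.
have ND := cochain_additive cN; have GD := cochain_additive cG.
have MD := cochain_additive cM.
pose P m (f : seq A -> ghom N G) := [/\ @cochain k A (gHom N G) n f,
  @vanish_on k A (gHom N G) e f & forall s, (size s < m)%N ->
  gcomp q (f s) = alpha s /\ total_diff T nu b pG pN f s = phi s].
have P0 : P 0%N (fun _ => 0).
  by split=> //; apply: (@cochain0 k A (gHom N G)).
have step m f : P m f ->
    exists g, P m.+1 g /\ forall s, (size s < m)%N -> g s = f s.
  move=> [hf fe fm].
  pose psi s := phi s - total_diff T nu b pG pN f s.
  pose theta s := alpha s - gcomp q (f s).
  have hpsi : @cochain k A (gHom N G) (n - 1) psi.
    apply: (@cochainD k A (gHom N G)) => //; apply: (@cochainN k A (gHom N G)).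
    exact: cochain_total_diff.
  have htheta : @cochain k A (gHom N M) n theta.
    apply: (@cochainD k A (gHom N M)) => //; apply: (@cochainN k A (gHom N M)).
    apply: (@eq_cochain k A (gHom N M) _ _ _ (cup_strict false q f)); rewrite -[n]add0r.
    apply: cochain_cup => //; apply: cochain_strict; exact: hq.1.
  have psie : @vanish_on k A (gHom N G) e psi.
    move=> u w; rewrite /psi phie (total_diff_unit (ainf_unitl hA) (ainf_unitr hA)
      (ainf_unit hA) (unit_bar_sign hA)) ?subr0 //.
    exact: (@cochain_additive k A (gHom N G)) hf.
  have thetae : @vanish_on k A (gHom N M) e theta.
    by move=> u w; rewrite /theta alphae fe gcomp0r subr0.
  have psi0 s : (size s < m)%N -> psi s = 0 by move=> hs; rewrite /psi (fm s hs).2 subrr.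
  have theta0 s : (size s < m)%N -> theta s = 0 by move=> hs; rewrite /theta (fm s hs).1 subrr.
  have fD := @cochain_additive k A (gHom N G) _ _ hf.
  have dpsi s : total_diff T nu (~~ b) pG pN psi s = 0.
    rewrite total_diffD total_diffN dphi total_diffK ?subrr //.
      exact: bar_signK.
    exact: ainf_square hA.
  have qpsi s : gcomp q (psi s) = total_diff T nu b pM pN theta s.
    rewrite /psi gcompDr gcompNr qphi (@gcomp_total_diff _ _ _ _ _ _ _ q pN pG pM) //.
    by rewrite -total_diffN -total_diffD.
  have odd1 : odd `|n - 1|%N = ~~ b by rewrite odd_absz_add nb addbT.
  have [||chi [hchi chie chi0 qchi dchi]] := cochain_lift hA hsp (l := m)
    (hom_is_diff dN dG) (hom_is_diff dN dM) (hom_post_chain_map dN dG dM hq)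
    (hom_post_fibration dN dG dM hq spN hqs) htheta thetae hpsi psie.
  - by move=> s hs; rewrite -(total_diff_leading nu dN dG hpsi psi0 hs) odd1 dpsi.
  - move=> s hs; rewrite -(total_diff_leading nu dN dM htheta theta0 hs) nb -qpsi.
    exact: hom_postE hq _.
  have chi_below s : (size s < m)%N -> chi s = 0.
    by move=> hs; apply: chi0 => e0; rewrite e0 ltnn in hs.
  exists (fun s => f s + chi s); split=> [|s hs]; last by rewrite chi_below ?addr0.
  split=> [|u w|s]; first exact: (@cochainD k A (gHom N G)).
    by rewrite fe chie addr0.
  rewrite ltnS leq_eqVlt gcompDr total_diffD => /orP[/eqP hs|hs].
    have := qchi s hs; rewrite (hom_postE hq) => ->.
    split; first by rewrite addrC subrK.
    rewrite -nb (total_diff_leading nu dN dG hchi chi_below hs) dchi // nb.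
    by rewrite addrC subrK.
  rewrite chi_below // gcomp0r (total_diff_below nu _ _ _ chi_below hs) !addr0.
  exact: fm.
have [f hf] := build_by_degree P0 step.
exists f; split.
- apply: (@cochain_local (gHom N G)) => m; have [g [[hg _ _] fg]] := hf m.
  by exists g.
- move=> u w; have [g [[_ ge _] fg]] := hf (size (u ++ e :: w)).+1.
  by rewrite fg // ge.
- move=> s; have [g [[_ _ gm] fg]] := hf (size s).+1.
  by rewrite fg // (gm s _).1.
move=> s; have [g [[_ _ gm] fg]] := hf (size s).+1.
rewrite -(gm s _).2 // /total_diff; congr (_ + _ *: (_ + _)).
- by apply: eq_cup => // t ht; apply: fg.
- by apply: eq_cup => // t ht; apply: fg.
by apply: eq_insert_size => t ht; apply: fg.
Qed.

End Linear.
End Lifting.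

(** * Lifting a module structure *)

Section Structure.
Variables (k : comPzRingType) (A : gmod k) (e : A) (sigma : {scalar A}).
Variable nu : seq A -> A.
Hypothesis hA : ainf_split_unit e sigma nu.
Hypothesis hsp : semiprojective (nu1 nu).
Local Notation T := (@bar_sign k A).

(** The strictly unital cochain with the prescribed differential whose reduced
    part vanishes. Corrections to it may then be taken among cochains killing
    the unit. *)
Definition unital_seed (G : gmod k) (dG : ghom G G) (s : seq A) : ghom G G :=
  match s with
  | [::] => dG
  | [:: a] => sigma a *: gid G
  | _ => 0
  end.

Lemma cochain_unital_seed (G : gmod k) (dG : ghom G G) :
  is_diff dG -> @cochain k A (gHom G G) (-1) (unital_seed dG).
Proof.
move=> [hG _]; split=> [[|z [|z' s1]] [|y' s2] a x y|[|x [|y s]] i] /=;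
  rewrite ?scaler0 ?addr0 //.
- by rewrite linearP scalerDl scalerA.
- by move=> ->; rewrite add0r.
- case=> j hx /eqP; rewrite subr_eq0 => /eqP ->.
  have [->|j1] := eqVneq j 1.
    apply: (@homogZ k (gHom G G)); apply/homog_homP => l z hz.
    by rewrite addr0.
  by rewrite (sigma_homog hA j1 hx) scale0r; apply: homog0.
by move=> _; apply: homog0.
Qed.

(** The approximations p satisfy p p + p nu = 0 and q p = pM q in tensor degrees
    below m. The leading terms of the curvature and of the strictness defect
    pM q - q p satisfy the hypotheses of cochain_lift, by the Bianchi identity
    and strictness_defect, and adding the correction changes the curvature in
    tensor degree m only by its differential. *)
Lemma structure_lift (G M : gmod k) (dG : ghom G G) (q : ghom G M)
    (pM : seq A -> ghom M M) :
  is_su_module e nu pM -> surj_semiproj_resolution dG (pM [::]) q ->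
  exists pG : seq A -> ghom G G,
    [/\ pG [::] = dG, is_su_module e nu pG & is_mod_mor nu pG pM (strict q)].
Proof.
move=> hM [spG hq hqs].
have [cM uM M1 mM] := (su_moduleP e nu pM).1 hM.
have dGd := spG.1; have [[_ dMd _] _] := hM.
have cnu := ainf_cochain hA.
have nuT := cochain_nuT cnu.
have nuD := cochain_additive cnu.
pose P m (p : seq A -> ghom G G) := [/\ @cochain k A (gHom G G) (-1) p,
  vanish_from2 e p, p [:: e] = gid G, p [::] = dG &
  forall s, (size s < m)%N ->
    curvature T nu p s = 0 /\ gcomp q (p s) = gcomp (pM s) q].
have P0 : P 0%N (unital_seed dG).
  split=> //; first exact: cochain_unital_seed.
    by move=> [|x [|y u]] [|z w].
  by rewrite /= (sigma_unit hA) scale1r.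
have step m p : P m p ->
    exists p', P m.+1 p' /\ forall s, (size s < m)%N -> p' s = p s.
  move=> [hp up p1 p0 pm].
  (* In tensor degree 0 the equations say that dG is a differential and q a
     chain map; later the quadratic term of curvatureD has no component in the
     degree under consideration. *)
  case: m pm => [|m] pm.
    exists p; split=> //; split=> // -[|x s] //= _.
    rewrite /curvature /cup /= addr0 p0; split; first by apply: hom_ext; exact: dGd.2.
    by apply: hom_ext; exact: hq.2.
  pose psi s := - curvature T nu p s.
  pose theta s := gcomp (pM s) q - gcomp q (p s).
  have pD := @cochain_additive k A (gHom G G) _ _ hp.
  have hpsi : @cochain k A (gHom G G) (-1 - 1) psi.
    by apply: (@cochainN k A (gHom G G)); apply: cochain_curvature.
  have hqc := @cochain_strict k A G M q hq.1.
  have htheta : @cochain k A (gHom G M) (-1) theta.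
    apply: (@cochainD k A (gHom G M)).
      have E s : cup T false pM (strict q) s = gcomp (pM s) q.
        by rewrite cup_strictr map_id.
      apply: (@eq_cochain k A (gHom G M) _ _ _ E).
      by rewrite -[-1]addr0; apply: cochain_cup.
    apply: (@cochainN k A (gHom G M)).
    apply: (@eq_cochain k A (gHom G M) _ _ _ (cup_strict false q p)).
    by rewrite -[-1]add0r; apply: cochain_cup.
  have psie : @vanish_on k A (gHom G G) e psi.
    move=> u w; rewrite /psi (curvature_unit (ainf_unitl hA) (ainf_unitr hA)
      (ainf_unit hA) (unit_bar_sign hA)) ?oppr0 //.
  have thetae : @vanish_on k A (gHom G M) e theta.
    move=> u w; have [/eqP|uw] := eqVneq (size (u ++ w)) 0%N.
      rewrite size_eq0; case: u w => [|x u] [|y w] // _.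
      by rewrite /theta M1 p1 gcomp1l gcomp1r subrr.
    rewrite /theta uM ?up ?gcomp0l ?gcomp0r ?subrr // => /(congr1 size)/eqP.
      by rewrite (negPf uw).
    by rewrite (negPf uw).
  have psi0 s : (size s < m.+1)%N -> psi s = 0.
    by move=> hs; rewrite /psi (pm s hs).1 oppr0.
  have theta0 s : (size s < m.+1)%N -> theta s = 0.
    by move=> hs; rewrite /theta (pm s hs).2 subrr.
  have pd : is_diff (p [::]) by rewrite p0.
  have hqp : chain_map (p [::]) (pM [::]) q by rewrite p0.
  have hqsp : surj_quasi_iso (p [::]) (pM [::]) q by rewrite p0.
  have spp : semiprojective (p [::]) by rewrite p0.
  have [||chi [hchi chie chi0 qchi dchi]] := cochain_lift hA hsp (l := m.+1)
    (hom_is_diff pd pd) (hom_is_diff pd dMd) (hom_post_chain_map pd pd dMd hqp)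
    (hom_post_fibration pd pd dMd hqp spp hqsp) htheta thetae hpsi psie.
  - move=> s hs; rewrite -(total_diff_leading nu pd pd hpsi psi0 hs) total_diffN.
    rewrite bianchi ?oppr0 //; first exact: bar_signK.
    exact: ainf_square hA.
  - move=> s hs; rewrite -(total_diff_leading nu pd dMd htheta theta0 hs).
    by rewrite strictness_defect // (hom_postE hqp) gcompNr.
  have chi_below s : (size s < m.+1)%N -> chi s = 0.
    by move=> hs; apply: chi0 => e0; rewrite e0 ltnn in hs.
  exists (fun s => p s + chi s); split=> [|s hs]; last by rewrite chi_below ?addr0.
  split=> [|u w uw|||s].
  - exact: (@cochainD k A (gHom G G)).
  - by rewrite up // chie addr0.
  - by rewrite p1 (chie [::] [::]) addr0.
  - by rewrite p0 chi_below ?addr0.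
  rewrite ltnS => hs.
  rewrite curvatureD gcompDr (_ : cup T true chi chi s = 0) ?addr0; last first.
    apply: split_sum0 => u v uv.
    have [um|um] := eqVneq (size u) m.+1; last first.
      by rewrite chi0 ?gcomp0l // size_map; apply/eqP.
    rewrite (chi_below v) ?gcomp0r //; move: hs; rewrite -uv size_cat um.
    by rewrite -[X in (_ <= X)%N]addn0 leq_add2l leqn0 => /eqP ->.
  move: hs; rewrite leq_eqVlt => /orP[/eqP hs|hs].
    have := qchi s hs; rewrite (hom_postE hqp) => ->.
    rewrite (total_diff_leading nu pd pd hchi chi_below hs) dchi // /psi subrr.
    by rewrite addrC subrK.
  rewrite chi_below // gcomp0r (total_diff_below nu _ _ _ chi_below hs) !addr0.
  exact: pm.
have [p hp] := build_by_degree P0 step.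
have cp : @cochain k A (gHom G G) (-1) p.
  apply: (@cochain_local k A (gHom G G)) => m; have [g [[hg _ _ _ _] fg]] := hp m.
  by exists g.
have pq s : gcomp q (p s) = gcomp (pM s) q.
  by have [g [[_ _ _ _ gm] fg]] := hp (size s).+1; rewrite fg // (gm s _).2.
exists p; split.
- by have [g [[_ _ _ g0 _] fg]] := hp 1%N; rewrite fg.
- apply/su_moduleP; split=> //.
  + move=> u w uw; have [g [[_ gu _ _ _] fg]] := hp (size (u ++ e :: w)).+1.
    by rewrite fg // gu.
  + by have [g [[_ _ g1 _ _] fg]] := hp 2%N; rewrite fg.
  move=> s; have [g [[_ _ _ _ gm] fg]] := hp (size s).+1.
  rewrite -(gm s _).1 // /curvature; congr (_ + _).
    by apply: eq_cup => // t ht; apply: fg.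
  by apply: eq_insert_size => t ht; apply: fg.
by apply/strict_mod_morP => //; split=> //; exact: hq.1.
Qed.

End Structure.

(** * Lifting morphisms and homotopies *)

Section LiftingMorphisms.
Variables (k : comPzRingType) (A : gmod k) (e : A) (sigma : {scalar A}).
Variable nu : seq A -> A.
Hypothesis hA : ainf_split_unit e sigma nu.
Hypothesis hsp : semiprojective (nu1 nu).
Local Notation T := (@bar_sign k A).

Lemma su_mod_morP (M N : gmod k) (pM : seq A -> ghom M M) (pN : seq A -> ghom N N)
    (f : seq A -> ghom M N) :
  is_su_module e nu pN ->
  is_su_mod_mor e nu pM pN f <->
  [/\ @cochain k A (gHom M N) 0 f, @vanish_on k A (gHom M N) e f &
      forall s, total_diff T nu false pN pM f s = 0].
Proof.
move=> /su_moduleP[cN _ _ _]; split=> [[/(mod_morP _ _ _ cN)[hf df] fe]|[hf fe df]] //.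
by split=> //; apply/mod_morP.
Qed.

Lemma strict_su_mod_morP (M N : gmod k) (pM : seq A -> ghom M M)
    (pN : seq A -> ghom N N) (q : ghom M N) :
  is_su_module e nu pM -> is_su_module e nu pN ->
  @homog k (gHom M N) 0 q -> (forall s, gcomp q (pM s) = gcomp (pN s) q) ->
  is_su_mod_mor e nu pM pN (strict q).
Proof.
move=> /su_moduleP[cM _ _ _] /su_moduleP[cN _ _ _] hq qs.
by split; [apply/strict_mod_morP | case].
Qed.

Lemma su_mod_mor_comp (M1 M2 M3 : gmod k) (p1 : seq A -> ghom M1 M1)
    (p2 : seq A -> ghom M2 M2) (p3 : seq A -> ghom M3 M3)
    (g : seq A -> ghom M2 M3) (f : seq A -> ghom M1 M2) :
  is_su_module e nu p2 -> is_su_module e nu p3 ->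
  is_su_mod_mor e nu p2 p3 g -> is_su_mod_mor e nu p1 p2 f ->
  is_su_mod_mor e nu p1 p3 (mod_comp g f).
Proof.
move=> h2 h3 /(su_mod_morP _ _ h3)[hg ge dg] /(su_mod_morP _ _ h2)[hf fe df].
have E s : - cup T false g f s = mod_comp g f s.
  rewrite /mod_comp (@star_cup _ _ _ _ _ _ 1); last exact/(CCu_cochain 1).
  by rewrite int_sign1 scaleN1r.
rewrite -(funext E); apply/(su_mod_morP _ _ h3).
have cnu := ainf_cochain hA; have nuT := cochain_nuT cnu.
have gD := @cochain_additive k A (gHom M2 M3) _ _ hg.
split.
- by apply: (@cochainN k A (gHom M1 M3)); rewrite -[0]addr0; apply: cochain_cup.
- have ge2 : vanish_from2 e g by move=> v t _; apply: ge.
  have fe2 : vanish_from2 e f by move=> v t _; apply: fe.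
  move=> u w; rewrite (cup_unit (unit_bar_sign hA)) //.
  by rewrite (fe [::] [::]) (ge [::] [::]) gcomp0l gcomp0r scaler0 !if_same addr0 oppr0.
by move=> s; rewrite total_diffN (total_diff_cup (@bar_signK k A) nuT _ gD dg df) oppr0.
Qed.

Section Lifts.
Variables (N G M : gmod k) (q : ghom G M).
Variables (pN : seq A -> ghom N N) (pG : seq A -> ghom G G).
Variable pM : seq A -> ghom M M.
Hypotheses (hN : is_su_module e nu pN) (hG : is_su_module e nu pG).
Hypothesis hM : is_su_module e nu pM.
Hypothesis hq : chain_map (pG [::]) (pM [::]) q.
Hypothesis hqs : surj_quasi_iso (pG [::]) (pM [::]) q.
Hypothesis q_strict : forall s, gcomp q (pG s) = gcomp (pM s) q.
Hypothesis spN : semiprojective (pN [::]).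

Lemma total_diff0 (X Y : gmod k) b (pX : seq A -> ghom X X) (pY : seq A -> ghom Y Y) s :
  total_diff T nu b pY pX (fun _ => 0) s = 0.
Proof. exact: (@total_diff_below _ _ _ _ _ _ _ _ (size s).+1). Qed.

Lemma morphism_lift (alpha : seq A -> ghom N M) :
  is_su_mod_mor e nu pN pM alpha ->
  exists delta, is_su_mod_mor e nu pN pG delta /\
    forall s, gcomp q (delta s) = alpha s.
Proof.
move=> /(su_mod_morP _ _ hM)[ha ae da].
have [|||||delta [hd de qd dd]] := total_lift hA hsp hN hG hM hq hqs q_strict spN
  (n := 0) (b := false) (phi := fun _ => 0) _ _ _ ha ae.
- by [].
- exact: (@cochain0 k A (gHom N G)).
- by [].
- by move=> s; apply: total_diff0.
- by move=> s; rewrite gcomp0r da.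
by exists delta; split=> //; apply/su_mod_morP.
Qed.

(** The difference of two lifts is a cycle lying over 0, so it bounds by
    total_lift. *)
Lemma lift_homotopic (delta delta' : seq A -> ghom N G) :
  is_su_mod_mor e nu pN pG delta -> is_su_mod_mor e nu pN pG delta' ->
  (forall s, gcomp q (delta s) = gcomp q (delta' s)) ->
  su_homotopic e nu pN pG delta delta'.
Proof.
move=> /(su_mod_morP _ _ hG)[h1 e1 d1] /(su_mod_morP _ _ hG)[h2 e2 d2] qd.
have [|||||||r [hr re _ dr]] := total_lift hA hsp hN hG hM hq hqs q_strict spN
  (n := 1) (b := true) (phi := fun s => delta s - delta' s) (alpha := fun _ => 0).
- by [].
- apply: (@cochainD k A (gHom N G)); first exact: h1.
  exact: (@cochainN k A (gHom N G)).
- by move=> u w; rewrite e1 e2 subrr.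
- exact: (@cochain0 k A (gHom N M)).
- by [].
- by move=> s; rewrite total_diffD total_diffN d1 d2 subrr.
- by move=> s; rewrite total_diff0 gcompDr gcompNr qd subrr.
exists r; split=> //; apply: homotopyP => //.
by case/su_moduleP: hG.
Qed.

End Lifts.
End LiftingMorphisms.

Theorem theorem3p3 (k : comPzRingType) (A : gmod k) (e : A)
    (sigma : {scalar A}) (nu : seq A -> A)
    (hA : ainf_split_unit e sigma nu)
    (hsp : semiprojective (nu1 nu))
    (M : gmod k) (pM : seq A -> ghom M M)
    (hM : is_su_module e nu pM) :
  [/\ (* (1) *)
      forall (G : gmod k) (dG : ghom G G) (q : ghom G M),
        surj_semiproj_resolution dG (pM [::]) q ->
        exists pG : seq A -> ghom G G,
          [/\ pG [::] = dG, is_su_module e nu pG &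
              is_mod_mor nu pG pM (strict q)],
      (* (2) *)
      forall (G N : gmod k) (pG : seq A -> ghom G G) (pN : seq A -> ghom N N)
          (q : ghom G M) (alpha : seq A -> ghom N M),
        is_su_module e nu pG -> is_su_module e nu pN ->
        is_su_mod_mor e nu pG pM (strict q) ->
        is_su_mod_mor e nu pN pM alpha ->
        semiprojective (pN [::]) ->
        chain_map (pG [::]) (pM [::]) q ->
        surj_quasi_iso (pG [::]) (pM [::]) q ->
        exists delta : seq A -> ghom N G,
          is_su_mod_mor e nu pN pG delta /\
          forall s, mod_comp (strict q) delta s = alpha s,
      (* (3), uniqueness of the lift up to homotopy *)
      forall (G N : gmod k) (pG : seq A -> ghom G G) (pN : seq A -> ghom N N)
          (q : ghom G M) (alpha : seq A -> ghom N M),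
        is_su_module e nu pG -> is_su_module e nu pN ->
        is_su_mod_mor e nu pG pM (strict q) ->
        is_su_mod_mor e nu pN pM alpha ->
        semiprojective (pN [::]) ->
        chain_map (pG [::]) (pM [::]) q ->
        surj_quasi_iso (pG [::]) (pM [::]) q ->
        (forall n, (1 <= n)%N ->
           H_CCbar_vanishes e nu (pN [::]) (pG [::]) n 1) ->
        forall delta delta' : seq A -> ghom N G,
          is_su_mod_mor e nu pN pG delta ->
          is_su_mod_mor e nu pN pG delta' ->
          (forall s, mod_comp (strict q) delta s = alpha s) ->
          (forall s, mod_comp (strict q) delta' s = alpha s) ->
          su_homotopic e nu pN pG delta delta' &
      (* (3), uniqueness of the module structure up to homotopy equivalence *)
      forall (G : gmod k) (dG : ghom G G) (q : ghom G M),
        surj_semiproj_resolution dG (pM [::]) q ->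
        (forall n, (1 <= n)%N -> H_CCbar_vanishes e nu dG dG n 1) ->
        forall pG pG' : seq A -> ghom G G,
          is_su_module e nu pG -> is_su_module e nu pG' ->
          pG [::] = dG -> pG' [::] = dG ->
          is_mod_mor nu pG pM (strict q) ->
          is_mod_mor nu pG' pM (strict q) ->
          su_homotopy_equivalent e nu pG pG'].
Proof.
have strictP (G : gmod k) (pG : seq A -> ghom G G) (q : ghom G M) :
    is_su_module e nu pG -> is_mod_mor nu pG pM (strict q) ->
    @homog k (gHom G M) 0 q /\ forall s, gcomp q (pG s) = gcomp (pM s) q.
  have [cM _ _ _] := (su_moduleP e nu pM).1 hM.
  by move=> /su_moduleP[cG _ _ _] /(strict_mod_morP _ _ cM cG).
split.
- move=> G dG q; exact: (structure_lift hA hsp hM).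
(* by mod_comp_strict the underlying maps to be lifted are those of - alpha *)
- move=> G N pG pN q alpha hG hN [hq _] ha spN cq sq.
  have [q0 qs] := strictP _ _ _ hG hq.
  have na : is_su_mod_mor e nu pN pM (fun s => - alpha s).
    have [ca ae da] := (su_mod_morP _ _ hM).1 ha.
    apply/su_mod_morP => //; split; first exact: (@cochainN k A (gHom N M)).
      by move=> u w; rewrite ae oppr0.
    by move=> s; rewrite total_diffN da oppr0.
  have [delta [hd qd]] := morphism_lift hA hsp hN hG hM cq sq qs spN na.
  by exists delta; split=> // s; rewrite mod_comp_strict // qd opprK.
- move=> G N pG pN q alpha hG hN [hq _] _ spN cq sq _ delta delta' hd hd' qd qd'.
  have [q0 qs] := strictP _ _ _ hG hq.
  apply: (lift_homotopic hA hsp hN hG hM cq sq qs spN hd hd') => s.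
  by apply: oppr_inj; rewrite -!mod_comp_strict // qd qd'.
move=> G dG q [spG cq sq] _ pG pG' hG hG' eG eG' hq hq'.
have [q0 qs] := strictP _ _ _ hG hq; have [_ qs'] := strictP _ _ _ hG' hq'.
have spG1 : semiprojective (pG [::]) by rewrite eG.
have spG2 : semiprojective (pG' [::]) by rewrite eG'.
have cq1 : chain_map (pG [::]) (pM [::]) q by rewrite eG.
have cq2 : chain_map (pG' [::]) (pM [::]) q by rewrite eG'.
have sq1 : surj_quasi_iso (pG [::]) (pM [::]) q by rewrite eG.
have sq2 : surj_quasi_iso (pG' [::]) (pM [::]) q by rewrite eG'.
(* Composition of morphisms carries a sign, so the composite of two lifts of q
   would lie over - q. Lifting - q in one direction makes both composites, like
   the identities, lie over q. *)
have mq : is_su_mod_mor e nu pG pM (strict (- q)).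
  apply: strict_su_mod_morP => // [|s]; first exact: (@homogN k (gHom G M)).
  by rewrite gcompNl gcompNr qs.
have mq' : is_su_mod_mor e nu pG' pM (strict q) by apply: strict_su_mod_morP.
have [f [hf qf]] := morphism_lift hA hsp hG hG' hM cq2 sq2 qs' spG1 mq.
have [g [hg qg]] := morphism_lift hA hsp hG' hG hM cq1 sq1 qs spG2 mq'.
have idP (p : seq A -> ghom G G) : is_su_module e nu p ->
    is_su_mod_mor e nu p p (strict (gid G)).
  move=> hp; apply: strict_su_mod_morP => // [|s]; last by rewrite gcomp1l gcomp1r.
  by apply/homog_homP => i x hx; rewrite addr0.
have compE (G1 G2 G3 : gmod k) (p2 : seq A -> ghom G2 G2) (p3 : seq A -> ghom G3 G3)
    (b : seq A -> ghom G2 G3) (a : seq A -> ghom G1 G2) s :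
    is_su_module e nu p3 -> is_su_mod_mor e nu p2 p3 b ->
    mod_comp b a s = - cup (@bar_sign k A) false b a s.
  move=> h3 /(su_mod_morP _ _ h3)[hb _ _].
  rewrite /mod_comp (@star_cup _ _ _ _ _ _ 1); last exact/(CCu_cochain 1).
  by rewrite int_sign1 scaleN1r.
have qcup (p : seq A -> ghom G G) (b a : seq A -> ghom G G) (r : ghom G M) s :
    (forall t, gcomp q (b t) = strict r t) ->
    gcomp q (cup (@bar_sign k A) false b a s) = gcomp r (a s).
  move=> qb; rewrite -(cup_strict false r a).
  rewrite /cup (@split_sum_additive _ _ _ (gcomp q)); last exact: gcompDr.
  by apply: eq_split_sum => u v; rewrite gcompA qb.
have strictN t : gcomp q (strict (gid G) t) = strict q t.
  by case: t => [|x t] /=; rewrite ?gcomp1r ?gcomp0r.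
exists f, g; split=> //.
- apply: (lift_homotopic hA hsp hG hG hM cq1 sq1 qs spG1).
  + exact: (su_mod_mor_comp hA hG' hG hg hf).
  + exact: idP.
  move=> s; rewrite (compE _ _ _ pG' pG) // gcompNr (qcup pG _ _ q) // qf strictN.
  by case: s => [|x s] /=; rewrite ?opprK ?oppr0.
apply: (lift_homotopic hA hsp hG' hG' hM cq2 sq2 qs' spG2).
- exact: (su_mod_mor_comp hA hG hG' hf hg).
- exact: idP.
move=> s; rewrite (compE _ _ _ pG pG') // gcompNr (qcup pG _ _ (- q)) //.
by rewrite gcompNl opprK qg strictN.
Qed.
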